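(* Let $G=(V,E,\mu,w)$ be a connected, locally finite and stochastically complete graph. Let $s\in(0,1)$, $p\in[2,+\infty)$ and assume $\inf_{x\in V}\mu(x)>0$. Then the fractional Sobolev space $W^{s,p}_0(V)$ satisfies the following properties: (i) $W^{s,p}_0(V)$ is a reflexive Banach space; (ii) if $u\in W^{s,p}_0(V)$, then $u^+,u^-,|u|\in W^{s,p}_0(V)$, where $u^+=\max\{u,0\}$, $u^-=\min\{u,0\}$ and $|u|=u^+-u^-$.
   Context: $G=(V,E,\mu,w)$ is a weighted graph with countable vertex set $V$, edge set $E$, positive vertex measure $\mu:V\to(0,+\infty)$ and positive symmetric edge weight $w_{xy}=w_{yx}>0$ ($xy\in E$); locally finite means every vertex has finitely many neighbours. Write $\int_V g\,d\mu=\sum_{x\in V}g(x)\mu(x)$. Let $p(t,x,y)$ be the (minimal) heat kernel of $G$, i.e. of the Laplacian $\Delta u(x)=\frac1{\mu(x)}\sum_{y\sim x}w_{xy}(u(y)-u(x))$. $G$ is stochastically complete if $\sum_{y\in V}p(t,x,y)\mu(y)=1$ for all $t>0$, $x\in V$. (The exponent $p$ below is unrelated to the heat kernel.) For $s\in(0,1)$ and $x\ne y\in V$, set $$W_s(x,y)=\frac{s}{\Gamma(1-s)}\mu(x)\mu(y)\int_0^{+\infty}p(t,x,y)\,t^{-1-s}\,dt,$$ where $\Gamma(\cdot)$ is the Gamma function. $L^\infty(V)$ is the space of bounded functions $V\to\mathbb R$. For $u\in L^\infty(V)$, $$|\nabla^su|(x)=\Big(\frac1{2\mu(x)}\sum_{y\in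 V,\,y\ne x}W_s(x,y)(u(x)-u(y))^2\Big)^{1/2}.$$ For $s\in(0,1)$, $p\in[2,+\infty)$, $$W^{s,p}(V)=\Big\{u\in L^\infty(V):\int_V(|\nabla^su|^p+|u|^p)\,d\mu<+\infty\Big\},\qquad \|u\|_{W^{s,p}(V)}=\Big(\int_V(|\nabla^su|^p+|u|^p)\,d\mu\Big)^{1/p}.$$ $C_c(V)$ is the set of functions $u:V\to\mathbb R$ with finite support, and $W^{s,p}_0(V)$ is the completion of $C_c(V)$ under the norm $\|\cdot\|_{W^{s,p}(V)}$, regarded as a closed subspace of $W^{s,p}(V)$. *)

(* Defs.v *)
From HB Require Import structures.
From mathcomp Require Import all_boot all_order all_algebra.
From mathcomp Require Import finmap.
From mathcomp Require Import all_classical all_reals all_analysis.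

Set Implicit Arguments.
Unset Strict Implicit.
Unset Printing Implicit Defensive.
Import Order.TTheory GRing.Theory Num.Theory.
Import numFieldNormedType.Exports.
Local Open Scope classical_set_scope.
Local Open Scope ring_scope.

(* The values of [wt] outside the edge relation are irrelevant. Loops are not
   excluded; they do not contribute to the Laplacian. *)
Record weighted_graph (R : realType) (V : countType) := WeightedGraph {
  edge : rel V;
  wt : V -> V -> R;
  mu : V -> R;
  edge_sym : forall x y, edge x y -> edge y x;
  wt_sym : forall x y, edge x y -> wt x y = wt y x;
  wt_gt0 : forall x y, edge x y -> 0 < wt x y;
  mu_gt0 : forall x, 0 < mu x }.

Section Graph.
Context {R : realType} {V : countType} (G : weighted_graph R V).

Definition locally_finite : Prop :=
  forall x, finite_set [set y | edge G x y].

Definition connected_graph : Prop :=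
  forall x y, exists q : seq V, path (edge G) x q /\ last x q = y.

Definition laplacian (u : V -> R) (x : V) : R :=
  (mu G x)^-1 * \sum_(y \in [set y | edge G x y]) wt G x y * (u y - u x).

(* To be applied to functions vanishing outside Om: edges leaving Om then still
   contribute to the diagonal (killing at the boundary). *)
Definition dirichlet_laplacian (Om : {fset V}) (u : V -> R) : V -> R :=
  fun x => if x \in Om then laplacian u x else 0.

Definition dirichlet_semigroup (Om : {fset V}) (t : R) (u : V -> R) (x : V) : R :=
  limn (series (fun k => t ^+ k / k`!%:R * iter k (dirichlet_laplacian Om) u x)).

Definition dirichlet_heat_kernel (Om : {fset V}) (t : R) (x y : V) : R :=
  if y \in Om
  then (mu G y)^-1 * dirichlet_semigroup Om t (fun z => (z == y)%:R) x
  else 0.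

(* The minimal heat kernel, by exhaustion. The Dirichlet kernels are
   nondecreasing in Om and bounded by 1 / mu y, so that this supremum is their
   limit along any exhaustion of V by finite sets. *)
Definition heat_kernel (t : R) (x y : V) : R :=
  sup [set dirichlet_heat_kernel Om t x y | Om in [set: {fset V}]].

Definition stochastically_complete : Prop :=
  forall (t : R) (x : V), 0 < t ->
    (\esum_(y in [set: V]) (heat_kernel t x y * mu G y)%:E = 1)%E.

(* Integral over V of a nonnegative function. *)
Definition vertex_integral (g : V -> \bar R) : \bar R :=
  (\esum_(x in [set: V]) (g x * (mu G x)%:E))%E.

Definition Gamma (z : R) : R :=
  \int[lebesgue_measure]_(t in `]0, +oo[) (t `^ (z - 1) * expR (- t)).

(* Only meaningful for x != y. *)
Definition frac_weight (s : R) (x y : V) : \bar R :=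
  ((s / Gamma (1 - s) * mu G x * mu G y)%:E *
   \int[lebesgue_measure]_(t in `]0%R, +oo[)
      (heat_kernel t x y * t `^ (- 1 - s))%:E)%E.

Definition frac_grad (s : R) (u : V -> R) (x : V) : \bar R :=
  (((2 * mu G x)^-1%:E *
    \esum_(y in [set y | y != x]) (frac_weight s x y * ((u x - u y) ^+ 2)%:E))
   `^ 2^-1)%E.

Definition sobolev_energy (s p : R) (u : V -> R) : \bar R :=
  vertex_integral (fun x => (frac_grad s u x `^ p + (`|u x| `^ p)%:E)%E).

Definition sobolev_norm (s p : R) (u : V -> R) : \bar R :=
  (sobolev_energy s p u `^ p^-1)%E.

Definition sobolev (s p : R) : set (V -> R) :=
  [set u | [bounded u x | x in [set: V]] /\ (sobolev_energy s p u < +oo)%E].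

Definition finitely_supported : set (V -> R) :=
  [set u | finite_set [set x | u x != 0]].

(* The completion of the finitely supported functions, realized as their
   closure in [sobolev s p]. *)
Definition sobolev0 (s p : R) : set (V -> R) :=
  [set u | sobolev s p u /\
     forall e : R, 0 < e -> exists2 phi, finitely_supported phi &
       (sobolev_norm s p (u \- phi)%R < e%:E)%E].

End Graph.

Section Reflexive.
Context {R : realType}.

Definition cdual (B : normedModType R) : set (B -> R^o) :=
  [set f | linear f /\ continuous f].

Definition cdual_norm (B : normedModType R) (f : B -> R^o) : R :=
  sup [set `|f x| | x in [set x : B | `|x| <= 1]].

(* Every bounded linear functional on the dual is an evaluation; the values of
   Phi outside the dual are irrelevant. *)
Definition reflexive_space (B : normedModType R) : Prop :=
  forall Phi : (B -> R^o) -> R,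
    (forall (a : R) f g, cdual f -> cdual g ->
       Phi (a *: f + g) = a * Phi f + Phi g) ->
    (exists C : R, forall f, cdual f -> `|Phi f| <= C * cdual_norm f) ->
  exists x : B, forall f, cdual f -> Phi f = f x.

(* The set S of functions, with pointwise operations and the norm N, is a
   reflexive Banach space: it is the isometric image of one. *)
Definition reflexive_banach (V : Type) (S : set (V -> R^o))
    (N : (V -> R^o) -> \bar R) : Prop :=
  exists (B : completeNormedModType R) (J : {linear B -> (V -> R^o)}),
    [/\ injective J, range J = S,
        forall b : B, (`|b|%:E = N (J b))%E & reflexive_space B].

End Reflexive.

(* Main.v *)
Require Import Defs.
From HB Require Import structures.
From mathcomp Require Import all_boot all_order all_algebra.
From mathcomp Require Import finmap.
From mathcomp Require Import all_classical all_reals all_analysis.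
From mathcomp Require Import ring lra.

Set Implicit Arguments.
Unset Strict Implicit.
Unset Printing Implicit Defensive.

Import Order.TTheory GRing.Theory Num.Theory.
Import numFieldNormedType.Exports.
Local Open Scope classical_set_scope.
Local Open Scope ring_scope.

(** Of the weights [frac_weight G s x y] the proof retains only that they are
    nonnegative extended reals: an infinite weight would only force two values
    of every function of finite energy to be equal.  Cutting the weights off at [n] and the
    vertices at the [n]-th one of an enumeration gives finite sums
    [partial_energy], which increase to the energy [sobolev_energy]
    ([cvg_partial_energy]).  Each of them is a combination, with nonnegative
    coefficients, of powers [Q `^ (p / 2)] where [Q] is a sum of squares of
    linear forms and [1 <= p / 2].  Four properties are evident on the finite
    sums and pass to the limit: the energy [E] is convex and homogeneous, so that its
    [p]-th root [N] is a seminorm; it is lower semicontinuous for pointwise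
    convergence ([sobolev_norm_fatou]); it decreases when [u] is composed with a
    contraction of the line that fixes 0 ([sobolev_norm_contraction]); and it
    satisfies Clarkson's inequality
    [E ((u + v) / 2) + E ((u - v) / 2) <= (E u + E v) / 2],
    by the parallelogram identity for [Q] ([sobolev_energy_clarkson]).

    As the measure is bounded below, [N] controls every value of [u], uniformly.
    Hence a Cauchy filter converges pointwise, and by lower semicontinuity it
    converges in norm, so the space is complete.  Clarkson's inequality makes it
    uniformly convex, and a uniformly convex Banach space is reflexive
    ([uniformly_convex_reflexive]).

    For the second part let [F] be a contraction fixing 0 and let finitely
    supported [phi n] tend to [u] in norm.  The functions [F \o phi n] are
    finitely supported, bounded in norm, and tend to [F \o u], but only
    pointwise, since composition with [F] need not be continuous for [N].  This
    is enough ([sobolev0_bounded_pointwise]): the finitely supported functions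
    of bounded norm that are pointwise close to the limit form convex sets, and
    by Clarkson's inequality almost minimizers of the energy on these sets are
    close to each other in norm.  This replaces the extraction of a weak limit
    followed by Mazur's lemma. *)

(** * Functionals on a normed space *)

Section DualNorm.
Context {R : realType} {B : normedModType R}.
Implicit Types (f g : B -> R^o) (x y : B).

Definition uniformly_convex_space :=
  forall e : R, 0 < e -> exists2 d : R, 0 < d &
    forall x y, `|x| <= 1 -> `|y| <= 1 -> 2 - d <= `|x + y| -> `|x - y| <= e.

Lemma cdualP f (a : R) x y : cdual f -> f (a *: x + y) = a * f x + f y :> R.
Proof. by move=> [lf _]; exact: lf. Qed.

Lemma cdualD f x y : cdual f -> f (x + y) = f x + f y :> R.
Proof. by move=> /(@cdualP _ 1 x y); rewrite scale1r mul1r. Qed.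

Lemma cdual_fun0 f : cdual f -> f 0 = 0 :> R.
Proof. by move=> /(@cdualP _ (-1) 0 0); rewrite scaler0 add0r mulN1r addNr. Qed.

Lemma cdualZ f a x : cdual f -> f (a *: x) = a * f x :> R.
Proof.
by move=> df; have := @cdualP f a x 0 df; rewrite cdual_fun0// !addr0.
Qed.

Lemma cdual_comb (a : R) f g : cdual f -> cdual g -> cdual (a *: f + g).
Proof.
move=> df dg; split.
  move=> b x y.
  change (a * f (b *: x + y) + g (b *: x + y) =
    b * (a * f x + g x) + (a * f y + g y)).
  by rewrite !cdualP//; ring.
move=> x; apply: (@cvgD _ R^o); last exact: dg.2.
by apply: (@cvgZ _ R^o); [exact: cvg_cst|exact: df.2].
Qed.

Lemma cdual0 : cdual (0 : B -> R^o).
Proof.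
split; first by move=> b x y; change (0 = b * 0 + 0 :> R); rewrite mulr0 addr0.
by move=> x; exact: cvg_cst.
Qed.

Lemma cdual_has_sup f : cdual f ->
  has_sup [set `|f x| | x in [set x : B | `|x| <= 1]].
Proof.
move=> [lf cf]; split.
  by exists `|f 0|, 0 => //=; rewrite normr0.
pose F : {linear B -> R^o} := HB.pack f (GRing.isLinear.Build R B R^o *:%R f lf).
have /linear_boundedP Fb : bounded_near F (nbhs 0).
  by apply: continuous_linear_bounded; exact: cf.
near (pinfty_nbhs R) => r.
have Fr : forall x, `|f x| <= r * `|x| by near: r; exact: Fb.
exists r => _ [x /= x1 <-].
apply: (le_trans (Fr x)); rewrite ler_piMr//.
Unshelve. all: by end_near. Qed.

Lemma cdual_norm_ge0 f : cdual f -> 0 <= cdual_norm f.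
Proof.
move=> df; apply: ub_le_sup; first exact: (cdual_has_sup df).2.
by exists 0 => /=; [rewrite normr0|rewrite cdual_fun0 ?normr0].
Qed.

Lemma cdual_le_norm f x : cdual f -> `|f x| <= cdual_norm f * `|x|.
Proof.
move=> df; have [->|x0] := eqVneq x 0.
  by rewrite cdual_fun0// !normr0 mulr0.
have nx0 : 0 < `|x| by rewrite normr_gt0.
rewrite -ler_pdivrMr//; apply: ub_le_sup; first exact: (cdual_has_sup df).2.
exists (`|x|^-1 *: x) => /=.
  by rewrite normrZ normfV normr_id mulVf ?normr_eq0.
by rewrite cdualZ// normrM normfV normr_id mulrC.
Qed.

Lemma cdual_le_norm1 f x : cdual f -> `|x| <= 1 -> f x <= cdual_norm f.
Proof.
move=> df x1; apply: (le_trans (ler_norm _)).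
apply: (le_trans (cdual_le_norm x df)).
by rewrite ler_piMr// cdual_norm_ge0.
Qed.

(** The norm is a supremum of absolute values; the sign is absorbed by
    replacing [x] by its opposite. *)
Lemma cdual_near_norm f e : cdual f -> 0 < e ->
  exists2 x, `|x| <= 1 & cdual_norm f - e < f x.
Proof.
move=> df e0; have [_ [x /= x1 <-] ltx] := sup_adherent e0 (cdual_has_sup df).
have [fx0|fx0] := lerP 0 (f x).
  by exists x => //; rewrite ger0_norm// in ltx.
exists ((-1) *: x); first by rewrite normrZ normrN1 mul1r.
by rewrite cdualZ// mulN1r; rewrite ltr0_norm// in ltx.
Qed.

Lemma cdual_norm_le f c : cdual f -> (forall x, `|x| <= 1 -> `|f x| <= c) ->
  cdual_norm f <= c.
Proof.
move=> df Hf; apply: ge_sup; first exact: (cdual_has_sup df).1.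
by move=> _ [x /= x1 <-]; exact: Hf.
Qed.

Lemma cdual_normZ f a : cdual f -> cdual_norm (a *: f) = `|a| * cdual_norm f.
Proof.
have le_normZ b g : cdual g -> cdual_norm (b *: g) <= `|b| * cdual_norm g.
  move=> dg; apply: cdual_norm_le.
    by have := cdual_comb b dg cdual0; rewrite addr0.
  move=> x x1; rewrite [X in `|X|](_ : _ = b * g x)// normrM.
  rewrite ler_wpM2l//; apply: (le_trans (cdual_le_norm x dg)).
  by rewrite ler_piMr// cdual_norm_ge0.
move=> df; apply/eqP; rewrite eq_le le_normZ//=.
have [->|a0] := eqVneq a 0.
  rewrite normr0 mul0r cdual_norm_ge0//.
  by have := cdual_comb 0 df cdual0; rewrite addr0.
rewrite mulrC -ler_pdivlMr ?normr_gt0// mulrC -normfV.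
rewrite -[X in cdual_norm X <= _](_ : a^-1 *: (a *: f) = _); last first.
  by rewrite scalerA mulVf// scale1r.
by apply: le_normZ; have := cdual_comb a df cdual0; rewrite addr0.
Qed.

End DualNorm.

(** * Uniformly convex Banach spaces are reflexive *)

Section MilmanPettis.
Context {R : realType} {B : completeNormedModType R}.
Hypothesis Bconvex : uniformly_convex_space (B := B).

(** If [Phi] of norm 1 is to be the evaluation at [x], then [x] is almost
    normed by each functional [f] of the unit ball at which [Phi] is almost 1.
    The points with this property for at least one such [f] are candidates for
    [x], up to an error controlled by [d]. *)
Definition norming_slice (Phi : (B -> R^o) -> R) (d : R) : set B :=
  [set x | `|x| <= 1 /\ exists f : B -> R^o,
    [/\ cdual f, cdual_norm f <= 1, 1 - d <= Phi f & 1 - d <= f x]].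

Lemma norming_sliceS Phi d d' : d <= d' ->
  norming_slice Phi d `<=` norming_slice Phi d'.
Proof.
move=> dd' x [x1 [f [df f1 Pf fx]]]; split=> //; exists f.
by split=> //; lra.
Qed.

Section Normalized.
Variable Phi : (B -> R^o) -> R.
Hypothesis PhiP : forall (a : R) f g, cdual f -> cdual g ->
  Phi (a *: f + g) = a * Phi f + Phi g.
Hypothesis Phi_le : forall f, cdual f -> Phi f <= cdual_norm f.
Hypothesis Phi_ge : forall e : R, 0 < e ->
  exists f, [/\ cdual f, cdual_norm f <= 1 & 1 - e <= Phi f].

Lemma norming_slice_neq0 d : 0 < d -> norming_slice Phi d !=set0.
Proof.
move=> d0; have d20 : 0 < d / 2 by rewrite divr_gt0.
have [f [df f1 Pf]] := Phi_ge d20.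
have [x x1 fx] := cdual_near_norm df d20.
exists x; split=> //; exists f; split=> //; first lra.
by have := Phi_le df; lra.
Qed.

(** Let [x] and [y] lie in the slice because of [f] and [g].  As
    [Phi (f + g)] is almost 2, some [z] in the unit ball almost norms [f + g],
    hence both [f] and [g]; uniform convexity then puts [x] and [y] near [z]. *)
Lemma norming_slice_diam e : 0 < e -> exists2 d, 0 < d &
  forall x y, norming_slice Phi d x -> norming_slice Phi d y -> `|x - y| <= e.
Proof.
move=> e0; have e20 : 0 < e / 2 by rewrite divr_gt0.
have [d d0 Hd] := Bconvex e20.
(* A functional that almost norms x and z gives x + z a norm close to 2. *)
have close (f : B -> R^o) (x z : B) : cdual f -> cdual_norm f <= 1 -> `|x| <= 1 -> `|z| <= 1 ->
    1 - d / 2 <= f x -> 1 - d / 2 <= f z -> `|x - z| <= e / 2.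
  move=> df f1 x1 z1 fx fz; apply: Hd => //.
  have : f (x + z) <= cdual_norm f * `|x + z|.
    exact: le_trans (ler_norm _) (cdual_le_norm _ df).
  rewrite (cdualD x z df) => H.
  suff : cdual_norm f * `|x + z| <= `|x + z| by lra.
  by rewrite ler_piMl.
have d60 : 0 < d / 6 by rewrite divr_gt0.
exists (d / 6) => // x y [x1 [f [df f1 Pf fx]]] [y1 [g [dg g1 Pg gy]]].
have dfg : cdual (f + g) by have := cdual_comb 1 df dg; rewrite scale1r.
have [z z1 fgz] := cdual_near_norm dfg d60.
have Pfg : Phi (f + g) = Phi f + Phi g.
  by have := PhiP 1 df dg; rewrite scale1r mul1r.
have := Phi_le dfg; rewrite Pfg => Nfg.
have {}fgz : cdual_norm (f + g) - d / 6 < f z + g z by [].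
have fz := cdual_le_norm1 df z1; have gz := cdual_le_norm1 dg z1.
have fz1 : 1 - d / 2 <= f z by lra.
have gz1 : 1 - d / 2 <= g z by lra.
rewrite -(subrK z x) -addrA; apply: (le_trans (ler_normD _ _)).
rewrite [e]splitr lerD//.
  by apply: (close f) => //; lra.
by rewrite distrC; apply: (close g) => //; lra.
Qed.

(** The slices are nonempty, decrease with [d], and shrink in diameter. *)
Lemma norming_slice_point : exists x : B, forall e, 0 < e -> exists2 d, 0 < d &
  forall y, norming_slice Phi d y -> `|y - x| <= e.
Proof.
have inv0 n : 0 < n.+1%:R^-1 :> R by rewrite invr_gt0.
pose u n := projT1 (cid (norming_slice_neq0 (inv0 n))).
have uP n : norming_slice Phi n.+1%:R^-1 (u n).
  by rewrite /u; case: cid.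
have near_u d : 0 < d -> \forall n \near \oo, norming_slice Phi d (u n).
  move=> d0; near=> n; apply: norming_sliceS (uP n).
  by apply: ltW; near: n; exact: near_infty_natSinv_lt (PosNum d0).
have cu : cvgn u.
  apply/cauchy_cvgP/cauchy_ballP => e e0; near_simpl.
  have e20 : 0 < e / 2 by rewrite divr_gt0.
  have [d d0 Hd] := norming_slice_diam e20.
  exists ((fun n => norming_slice Phi d (u n)), (fun n => norming_slice Phi d (u n))).
    by split; exact: near_u.
  move=> [n m] [/= un um]; rewrite -ball_normE/=.
  by apply: le_lt_trans (Hd _ _ un um) _; lra.
exists (limn u) => e e0; have e20 : 0 < e / 2 by rewrite divr_gt0.
have [d d0 Hd] := norming_slice_diam e20.
exists d => // y yd; near \oo => n.
rewrite -(subrK (u n) y) -addrA; apply: (le_trans (ler_normD _ _)).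
rewrite [e]splitr lerD//.
  by apply: Hd => //; near: n; exact: near_u.
rewrite distrC; near: n.
by move/cvgrPdist_le : cu; apply.
Unshelve. all: by end_near. Qed.

(** To compare [Phi g] with [g x], perturb [f] with [Phi f] almost 1 into
    [f + t g] for a small [t], and let [z] almost norm it.  Then [z] still
    almost norms [f], so [z] is close to [x], while
    [1 + t * Phi g <= f z + t * g z <= 1 + t * g z] up to errors of order
    [t ^+ 2]; divide by [t].  This amounts to the uniform smoothness of the
    dual norm. *)
Lemma normalized_is_evaluation : exists x : B, forall g, cdual g -> Phi g = g x.
Proof.
have [x Hx] := norming_slice_point.
exists x.
have Phi0 : Phi 0 = 0.
  have := PhiP (-1) cdual0 cdual0.
  by rewrite scaler0 addr0 mulN1r addNr.
have PhiN g : cdual g -> Phi (- g) = - Phi g.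
  move=> dg; have := PhiP (-1) dg cdual0.
  by rewrite Phi0 !addr0 scaleN1r mulN1r.
have dualN (g : B -> R^o) : cdual g -> cdual (- g).
  by move=> dg; have := cdual_comb (-1) dg cdual0; rewrite addr0 scaleN1r.
have key g : cdual g -> Phi g <= g x.
  move=> dg; set G := cdual_norm g.
  have G0 : 0 <= G by exact: cdual_norm_ge0.
  suff step e : 0 < e -> Phi g <= g x + (G + 2) * e.
    apply/ler_addgt0Pr => e e0.
    have G2 : 0 < G + 2 by lra.
    apply: (le_trans (step (e / (G + 2)) (divr_gt0 e0 G2))).
    by rewrite mulrC divfK ?gt_eqF.
  move=> e0; have [d d0 Hd] := Hx e e0.
  (* The bound by d / (2 G + 2) keeps z in the slice of depth d. *)
  pose t := Num.min 1 (Num.min e (d / (2 * G + 2))).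
  have G2 : 0 < 2 * G + 2 by lra.
  have t0 : 0 < t by rewrite !lt_min ltr01 e0 divr_gt0.
  have t1 : t <= 1 by rewrite ge_min lexx.
  have te : t <= e by rewrite !ge_min lexx orbT.
  have td : t * (2 * G + 2) <= d by rewrite -ler_pdivlMr// !ge_min lexx !orbT.
  have [f [df f1 Pf]] := Phi_ge (exprn_gt0 2 t0).
  have dh := cdual_comb t dg df.
  have [z z1 hz] := cdual_near_norm dh (exprn_gt0 2 t0).
  have := Phi_le dh; rewrite PhiP// => Nh.
  have {}hz : cdual_norm (t *: g + f) - t ^+ 2 < t * g z + f z by [].
  have fz := cdual_le_norm1 df z1.
  have gz : `|g z| <= G.
    by apply: (le_trans (cdual_le_norm z dg)); rewrite ler_piMr.
  have PG : - G <= Phi g.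
    have := Phi_le (cdual_comb (-1) dg cdual0).
    rewrite addr0 cdual_normZ// normrN1 mul1r scaleN1r PhiN// -/G; lra.
  have zx : `|z - x| <= e.
    apply: Hd; split=> //; exists f; split=> //; first nra.
    move: gz; rewrite ler_norml => /andP[gz1 gz2]; nra.
  have gzx : g z - g x <= G * e.
    rewrite -[g z - g x](_ : g (z - x) = _ :> R); last first.
      by rewrite (cdualD _ _ dg) -scaleN1r (cdualZ _ _ dg) mulN1r.
    apply: (le_trans (ler_norm _)); apply: (le_trans (cdual_le_norm _ dg)).
    by rewrite ler_wpM2l.
  have : t * Phi g <= t * (g z + 2 * t) by nra.
  rewrite ler_pM2l//; nra.
move=> g dg; apply/eqP; rewrite eq_le key//=.
by have := key _ (dualN _ dg); rewrite PhiN// lerN2.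
Qed.

End Normalized.

(** The Milman-Pettis theorem, proved without the weak-star density of the unit
    ball in the bidual: the representing point is found directly, after
    dividing [Phi] by its norm. *)
Theorem uniformly_convex_reflexive : reflexive_space B.
Proof.
move=> Phi PhiP [C PhiC].
have Phi0 : Phi 0 = 0.
  have := PhiP (-1) _ _ cdual0 cdual0.
  by rewrite scaler0 addr0 mulN1r addNr.
have PhiZ a f : cdual f -> Phi (a *: f) = a * Phi f.
  by move=> df; have := PhiP a _ _ df cdual0; rewrite Phi0 !addr0.
have dualZ a (f : B -> R^o) : cdual f -> cdual (a *: f).
  by move=> df; have := cdual_comb a df cdual0; rewrite addr0.
pose S := [set Phi f | f in [set f | cdual f /\ cdual_norm f <= 1]].
have norm0 : cdual_norm (0 : B -> R^o) = 0.
  by rewrite -(scale0r (0 : B -> R^o)) cdual_normZ ?normr0 ?mul0r//; exact: cdual0.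
have S0 : S 0.
  by exists 0 => //; split; [exact: cdual0|rewrite norm0].
have Ssup : has_sup S.
  split; first by exists 0.
  exists `|C| => _ [f [df f1] <-].
  apply: (le_trans (ler_norm _)); apply: (le_trans (PhiC f df)).
  have f0 := cdual_norm_ge0 df.
  apply: (@le_trans _ _ (`|C| * cdual_norm f)); first by rewrite ler_wpM2r// ler_norm.
  by rewrite ler_piMr.
set M := sup S.
have M0 : 0 <= M by exact: ub_le_sup Ssup.2 _ S0.
have PhiM f : cdual f -> Phi f <= M * cdual_norm f.
  move=> df; have := cdual_norm_ge0 df; rewrite le_eqVlt => /predU1P[f0|f0].
    by have := PhiC f df; rewrite -f0 !mulr0 normr_le0 => /eqP ->.
  rewrite -ler_pdivrMr//; apply: ub_le_sup Ssup.2 _ _.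
  exists ((cdual_norm f)^-1 *: f); last by rewrite PhiZ// mulrC.
  split; first exact: dualZ.
  by rewrite cdual_normZ// normfV (gtr0_norm f0) mulVf ?gt_eqF//.
have [M_eq0|M_neq0] := eqVneq M 0.
  exists 0 => f df; rewrite cdual_fun0//; apply/eqP; rewrite eq_le.
  have := PhiM _ (dualZ (-1) _ df); rewrite PhiZ// M_eq0 mul0r mulN1r oppr_le0 => ->.
  by rewrite andbT; have := PhiM _ df; rewrite M_eq0 mul0r.
have {M_neq0}M0 : 0 < M by rewrite lt_neqAle eq_sym M_neq0.
have [|||x Hx] := @normalized_is_evaluation (fun f => M^-1 * Phi f).
- by move=> a f g df dg; rewrite PhiP//; ring.
- by move=> f df; rewrite mulrC ler_pdivrMr// mulrC PhiM.
- move=> e e0; have [_ [f [df f1] <-] Hf] := sup_adherent (mulr_gt0 M0 e0) Ssup.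
  exists f; split=> //; rewrite mulrC ler_pdivlMr// mulrBl mul1r mulrC ltW//.
exists (M *: x) => g dg; rewrite cdualZ// -Hx//.
by rewrite mulrA mulfV ?mul1r// gt_eqF.
Qed.

End MilmanPettis.

(** * Complete spaces of functions *)

(** The data from which a Banach space of functions is built: an extended
    seminorm on all functions that controls their values and is lower
    semicontinuous for pointwise convergence, and a closed subspace of functions
    of finite norm. *)
Record function_space (R : realType) (V : Type) := FunctionSpace {
  fs_norm : (V -> R^o) -> \bar R;
  fs_set : set (V -> R^o);
  fs_norm_ge0 : forall u, (0 <= fs_norm u)%E;
  fs_normD : forall u v, (fs_norm (u + v)%R <= fs_norm u + fs_norm v)%E;
  fs_normZ : forall (a : R) u, fs_norm (a *: u) = (`|a|%:E * fs_norm u)%E;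
  fs_eval : forall x, exists C : R, forall u, ((`|u x|)%:E <= C%:E * fs_norm u)%E;
  fs_fatou : forall (F : set_system (V -> R^o)) (v : V -> R^o) (c : \bar R),
    ProperFilter F -> (forall x, w x @[w --> F] --> v x) ->
    (\forall w \near F, (fs_norm w <= c)%E) -> (fs_norm v <= c)%E;
  fs_fin : forall u, fs_set u -> (fs_norm u < +oo)%E;
  fs_submod : submod_closed (mem fs_set : {pred (V -> R^o)});
  fs_closed : forall v, (forall e : R, 0 < e ->
      exists2 u, fs_set u & (fs_norm (v - u)%R <= e%:E)%E) -> fs_set v }.

Section FunctionSpaceType.
Context {R : realType} {V : Type} (X : function_space R V).

Definition fs_pred : {pred (V -> R^o)} := mem (fs_set X).
HB.instance Definition _ :=
  GRing.isSubmodClosed.Build R (V -> R^o) fs_pred (fs_submod X).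

(** Membership is boolean, so that equal functions give equal elements. *)
Record fs_type := FsType { fs_val : V -> R^o; fs_valP : fs_val \in fs_pred }.

HB.instance Definition _ := [isSub for fs_val].
HB.instance Definition _ := [Choice of fs_type by <:].
HB.instance Definition _ := [SubChoice_isSubLmodule of fs_type by <:].

Definition fs_nrm (b : fs_type) : R := fine (fs_norm X (val b)).

Lemma fs_nrmE b : (fs_nrm b)%:E = fs_norm X (val b).
Proof.
rewrite /fs_nrm fineK// ge0_fin_numE ?fs_norm_ge0//.
by apply: fs_fin; have := fs_valP b; rewrite inE.
Qed.

Lemma fs_nrmD (b c : fs_type) : fs_nrm (b + c) <= fs_nrm b + fs_nrm c.
Proof. by rewrite -lee_fin EFinD !fs_nrmE raddfD fs_normD. Qed.

Lemma fs_nrmZ a (b : fs_type) : fs_nrm (a *: b) = `|a| * fs_nrm b.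
Proof. by apply: EFin_inj; rewrite EFinM !fs_nrmE linearZ fs_normZ. Qed.

Lemma fs_nrm_eval x : exists C : R, forall b : fs_type, `|val b x| <= C * fs_nrm b.
Proof.
have [C HC] := fs_eval X x; exists C => b.
by rewrite -lee_fin EFinM fs_nrmE.
Qed.

Lemma fs_nrm0_eq0 (b : fs_type) : fs_nrm b = 0 -> b = 0.
Proof.
move=> b0; apply: val_inj; apply/funext => x.
have [C HC] := fs_nrm_eval x; have := HC b; rewrite b0 mulr0 normr_le0 => /eqP ->.
by [].
Qed.

HB.instance Definition _ :=
  Lmodule_isNormed.Build R fs_type fs_nrmD fs_nrmZ fs_nrm0_eq0.

(** Evaluations are Lipschitz, so a Cauchy filter has a pointwise limit [v].
    Fixing [b] far along the filter and letting [c] run in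
    [fs_norm X (c - b) <= e], lower semicontinuity bounds
    [fs_norm X (v - b)] by [e]. *)
Lemma fs_complete (F : set_system fs_type) : ProperFilter F -> cauchy F -> cvg F.
Proof.
move=> FF cF.
have cF_ball : cauchy_ball F by apply/cauchy_ballP.
have evl x : cvg ((fun b : fs_type => val b x : R^o) @ F).
  have [C HC] := fs_nrm_eval x.
  apply/cauchy_cvgP/cauchy_ballP => e e0; near_simpl.
  have C1 : 0 < `|C| + 1 by rewrite ltr_wpDl.
  have /= := cF_ball _ (divr_gt0 e0 C1).
  apply: filterS => -[b c] /=; rewrite -!ball_normE /= => bc.
  have -> : val b x - val c x = val (b - c) x by [].
  apply: le_lt_trans (HC _) _.
  apply: (@le_lt_trans _ _ ((`|C| + 1) * fs_nrm (b - c))).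
    rewrite ler_wpM2r ?(normr_ge0 (b - c))//.
    by rewrite (le_trans (ler_norm _))// lerDl.
  by rewrite mulrC -ltr_pdivlMr.
pose v : V -> R^o := fun x => lim ((fun b : fs_type => val b x : R^o) @ F).
have near_v (e : R) : 0 < e ->
    \forall b \near F, (fs_norm X (v - val b)%R <= e%:E)%E.
  move=> e0; have [[P Q] /= [FP FQ] PQ] := cF_ball _ e0.
  apply: filterS FP => b Pb.
  apply: (fs_fatou (F := (fun c : fs_type => val c - val b) @ F)).
    move=> x; change ((fun c : fs_type => val c x - val b x) @ F --> v x - val b x).
    by apply: (@cvgB _ R^o); [exact: evl|exact: cvg_cst].
  apply: filterS FQ => c Qc.
  have := PQ (b, c) (conj Pb Qc); rewrite -ball_normE /= => /ltW.
  by rewrite distrC -lee_fin [X in (X%:E <= _)%E -> _]/(fs_nrm (c - b)) fs_nrmE raddfB.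
have Sv : fs_set X v.
  apply: fs_closed => e /near_v /filter_ex[b Hb].
  by exists (val b) => //; have := fs_valP b; rewrite inE.
have vP : v \in fs_pred by rewrite inE.
apply/cvg_ex; exists (FsType vP); apply/cvgrPdist_le => /= e e0.
apply: filterS (near_v _ e0) => b Hb.
by rewrite -lee_fin [X in (X%:E <= _)%E]/(fs_nrm (FsType vP - b)) fs_nrmE raddfB.
Qed.

HB.instance Definition _ := Uniform_isComplete.Build fs_type fs_complete.

End FunctionSpaceType.

(** * Clarkson's inequality and reflexivity *)

Section Clarkson.
Context {R : realType}.

Lemma clarkson_uniformly_convex (B : normedModType R) (p : R) : 0 < p ->
  (forall x y : B, `|2^-1 *: (x + y)| `^ p + `|2^-1 *: (x - y)| `^ p <=
     2^-1 * (`|x| `^ p + `|y| `^ p)) ->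
  uniformly_convex_space (B := B).
Proof.
move=> p0 clk e e0.
have e20 : 0 < e / 2 by rewrite divr_gt0.
have [e2|e2] := lerP 1 (e / 2).
  exists 1 => // x y x1 y1 _; have := ler_normB x y; lra.
have one r : 1 `^ r = 1 :> R by rewrite powR1.
have p_neq0 : p != 0 by rewrite gt_eqF.
have ep1 : (e / 2) `^ p < 1.
  by rewrite -[ltRHS](one p) gt0_ltr_powR// ?nnegrE//; exact: ltW.
have ep0 : 0 < (e / 2) `^ p by rewrite powR_gt0.
(* If |x + y| / 2 is at least a, Clarkson's inequality leaves for |x - y| / 2
   at most e / 2. *)
pose a := (1 - (e / 2) `^ p) `^ p^-1.
have a0 : 0 <= a by exact: powR_ge0.
have ap : a `^ p = 1 - (e / 2) `^ p by rewrite -powRrM mulVf// powRr1//; lra.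
have a1 : a < 1.
  by rewrite -[ltRHS](one p^-1) gt0_ltr_powR// ?invr_gt0// ?nnegrE; lra.
exists (2 * (1 - a)); first by lra.
move=> x y x1 y1 xy.
have half z : `|2^-1 *: z| = 2^-1 * `|z| :> R.
  by move: z => z; rewrite normrZ ger0_norm.
have xp : `|x| `^ p <= 1 by rewrite -[leRHS](one p) ge0_ler_powR// ?nnegrE// ltW.
have yp : `|y| `^ p <= 1 by rewrite -[leRHS](one p) ge0_ler_powR// ?nnegrE// ltW.
have := clk x y; rewrite !half => H.
have : a `^ p <= (2^-1 * `|x + y|) `^ p.
  by rewrite ge0_ler_powR// ?nnegrE// ?mulr_ge0//; [exact: ltW|lra].
rewrite ap => H2.
have {H H2} : (2^-1 * `|x - y|) `^ p <= (e / 2) `^ p by lra.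
case: (lerP `|x - y| e) => // xye.
suff : (e / 2) `^ p < (2^-1 * `|x - y|) `^ p by lra.
by rewrite gt0_ltr_powR// ?nnegrE ?mulr_ge0//; lra.
Qed.

Lemma clarkson_reflexive_banach (V : Type) (X : function_space R V) (p : R) :
  0 < p ->
  (forall u v, (fs_norm X (2^-1 *: (u + v))%R `^ p
      + fs_norm X (2^-1 *: (u - v))%R `^ p
      <= 2^-1%:E * (fs_norm X u `^ p + fs_norm X v `^ p))%E) ->
  reflexive_banach (fs_set X) (fs_norm X).
Proof.
move=> p0 clk; exists (fs_type X), (\val : {linear fs_type X -> (V -> R^o)}).
split.
- exact: val_inj.
- apply/seteqP; split=> [_ [b _ <-]|u Xu].
    by have := fs_valP b; rewrite inE.
  have uP : u \in fs_pred X by rewrite inE.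
  by exists (FsType uP).
- by move=> b; exact: fs_nrmE.
apply: uniformly_convex_reflexive; apply: (clarkson_uniformly_convex p0) => x y.
have := clk (val x) (val y).
rewrite -raddfD -raddfB -!linearZ -!fs_nrmE !poweR_EFin.
by rewrite -!EFinD -EFinM lee_fin.
Qed.

End Clarkson.

(** * Powers of real and extended real numbers *)

Section RealPowers.
Context {R : realType}.
Implicit Types r : R.

Lemma powR_le_conv r (t a b c : R) : 1 <= r -> 0 <= t <= 1 ->
  0 <= a -> 0 <= b -> 0 <= c -> c <= t * a + (1 - t) * b ->
  c `^ r <= t * a `^ r + (1 - t) * b `^ r.
Proof.
move=> r1 /andP[t0 t1] a0 b0 c0 cab.
apply: (@le_trans _ _ ((t * a + (1 - t) * b) `^ r)).
  rewrite ge0_ler_powR// ?nnegrE ?(le_trans _ r1)//.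
  by rewrite addr_ge0// mulr_ge0// subr_ge0.
have := @convex_powR R r r1 (Itv01 t0 t1) a b.
rewrite !inE /= !in_itv /= !andbT => /(_ a0 b0).
by rewrite !convRE.
Qed.

(** Each of [a / (a + b)] and [b / (a + b)] lies in the unit interval, where
    raising to a power at least 1 decreases. *)
Lemma powR_superadditive r (a b : R) : 1 <= r -> 0 <= a -> 0 <= b ->
  a `^ r + b `^ r <= (a + b) `^ r.
Proof.
move=> r1 a0 b0; have r_neq0 : r != 0 by rewrite gt_eqF// (lt_le_trans ltr01).
have [ab0|ab0] := eqVneq (a + b) 0.
  have -> : a = 0 by lra.
  have -> : b = 0 by lra.
  by rewrite addr0 !powR0// addr0.
have {ab0}ab0 : 0 < a + b by rewrite lt_neqAle eq_sym ab0 addr_ge0.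
have frac_le (c : R) : 0 <= c -> c <= a + b ->
    c `^ r <= c / (a + b) * (a + b) `^ r.
  move=> c_ge0 cab; have [->|c_neq0] := eqVneq c 0.
    by rewrite powR0// !mul0r.
  have {c_neq0}c0 : 0 < c by rewrite lt_neqAle eq_sym c_neq0.
  rewrite -{1}(divfK (lt0r_neq0 ab0) c); apply: ge1r_powRZ => //; last exact: ltW.
  by rewrite divr_gt0 ?ler_pdivrMr ?mul1r.
apply: (le_trans (lerD (frac_le a a0 _) (frac_le b b0 _))); try lra.
by rewrite -mulrDl -mulrDl mulfV ?mul1r// gt_eqF.
Qed.

(** The scalar core of Clarkson's inequality: [a], [b], [c] and [d] stand for
    the values of a quadratic form at [u], [v], [(u + v) / 2] and
    [(u - v) / 2], and the hypothesis on [c + d] is the parallelogram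
    identity. *)
Lemma powR_midpoint r (a b c d : R) : 1 <= r ->
  0 <= a -> 0 <= b -> 0 <= c -> 0 <= d -> c + d = 2^-1 * (a + b) ->
  c `^ r + d `^ r <= 2^-1 * (a `^ r + b `^ r).
Proof.
move=> r1 a0 b0 c0 d0 cd; apply: (le_trans (powR_superadditive r1 c0 d0)).
have h : 1 - 2^-1 = 2^-1 :> R by lra.
rewrite mulrDr -{2}h; apply: powR_le_conv => //; first lra; lra.
Qed.

Lemma cvg_powR_ge0 (T : Type) (F : set_system T) (f : T -> R) (a r : R) :
  Filter F -> 0 < r -> (forall t, 0 <= f t) -> 0 <= a ->
  f t @[t --> F] --> a -> f t `^ r @[t --> F] --> a `^ r.
Proof.
move=> FF r0 f0; rewrite le_eqVlt => /predU1P[<-|a0] fa.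
  rewrite powR0 ?gt_eqF//; apply/cvgr0Pnorm_lt => e e0.
  have er0 : 0 < e `^ r^-1 by rewrite powR_gt0.
  move/cvgr0Pnorm_lt : fa => /(_ _ er0); apply: filterS => t.
  rewrite !ger0_norm ?powR_ge0// => fte.
  have -> : e = (e `^ r^-1) `^ r by rewrite -powRrM mulVf ?gt_eqF// powRr1// ltW.
  by rewrite gt0_ltr_powR// nnegrE// ltW.
have powR_cont : {for a, continuous (@powR R ^~ r)}.
  apply: (@differentiable_continuous _ R^o R^o); apply/derivable1_diffP.
  by apply: derivable_powR; rewrite in_itv /= a0.
by have := cvg_comp _ _ fa powR_cont; apply.
Qed.

Local Open Scope ereal_scope.

Lemma cvg_poweR_ge0 (f : nat -> \bar R) (a : \bar R) r : (0 < r)%R ->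
  (forall n, 0 <= f n) -> f n @[n --> \oo] --> a ->
  f n `^ r @[n --> \oo] --> a `^ r.
Proof.
move=> r0 f0 fa; have a0 : 0 <= a by apply: cvge_to_ge fa _; exact: nearW.
case: a a0 fa => [a| |//] a0 fa.
  have /fine_cvgP[finf fa'] := fa.
  rewrite poweR_EFin; apply/fine_cvgP; split.
    by apply: filterS finf => n; exact: fin_num_poweR.
  have -> : fine \o (fun n => f n `^ r) = (fun n => (fine (f n) `^ r)%R).
    by apply/funext => n /=; rewrite fine_poweR.
  by apply: cvg_powR_ge0 => // n; exact: fine_ge0.
rewrite poweRyr ?gt_eqF//; apply/cvgeyPge => A.
have A0 : (0 <= `|A| `^ r^-1)%R by exact: powR_ge0.
move/cvgeyPge : fa => /(_ (`|A| `^ r^-1)%R); apply: filterS => n Hn.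
apply: (@le_trans _ _ (`|A|%:E)); first by rewrite lee_fin ler_norm.
have -> : `|A|%:E = ((`|A| `^ r^-1)%R)%:E `^ r.
  by rewrite poweR_EFin -powRrM mulVf ?gt_eqF// powRr1.
apply: gt0_ler_poweR => //; first exact: ltW.
- by rewrite in_itv /= lee_fin A0 leey.
- by rewrite in_itv /= f0 leey.
Qed.

End RealPowers.

(** * Sums over a countable set *)

Lemma near_all_seq (V : eqType) (T : Type) (F : set_system T)
    (P : V -> T -> Prop) (xs : seq V) :
  Filter F -> (forall x, \forall t \near F, P x t) ->
  \forall t \near F, forall x, x \in xs -> P x t.
Proof.
move=> FF FP; elim: xs => [|x xs IH]; first by apply: nearW => t y; rewrite in_nil.
apply: filterS2 (FP x) IH => t Px IH y.
by rewrite in_cons => /predU1P[->|/IH].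
Qed.

Section Exhaustion.
Context {V : countType}.

Definition exhaust (n : nat) : seq V := pmap pickle_inv (iota 0 n).

Lemma mem_exhaust n x : (x \in exhaust n) = (choice.pickle x < n)%N.
Proof.
rewrite /exhaust mem_pmap; apply/mapP/idP => [[k]|xn].
  rewrite mem_iota /= add0n => kn xk.
  by have := pickle_invK (T := V) k; rewrite -xk /= => ->.
by exists (choice.pickle x); rewrite ?mem_iota// pickleK_inv.
Qed.

Lemma uniq_exhaust n : uniq (exhaust n).
Proof. exact: pmap_uniq pickle_invK _ (iota_uniq _ _). Qed.

Lemma exhaust_cat n k : exhaust (n + k) = exhaust n ++ pmap pickle_inv (iota n k).
Proof. by rewrite /exhaust iotaD pmap_cat. Qed.

Lemma exhaust_finite_set (A : set V) : finite_set A ->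
  exists N, forall x, A x -> x \in exhaust N.
Proof.
move=> finA; exists (\max_(x <- fset_set A) choice.pickle x).+1 => x Ax.
rewrite mem_exhaust ltnS; apply: (@leq_bigmax_seq _ _ xpredT (fun x => choice.pickle x)) => //.
by rewrite in_fset_set// inE.
Qed.

Lemma le_exhaust_sum (R : realType) (a b : V -> R) n m : (n <= m)%N ->
  (forall x, a x <= b x) -> (forall x, 0 <= b x) ->
  \sum_(x <- exhaust n) a x <= \sum_(x <- exhaust m) b x.
Proof.
move=> /subnKC <- ab b0; rewrite exhaust_cat big_cat/=.
by rewrite ler_wpDr ?sumr_ge0// ler_sum.
Qed.

Local Open Scope ereal_scope.

(** Monotone convergence for sums, where the terms and the set of summation
    grow together. *)
Lemma cvg_exhaust_esum (R : realType) (a : nat -> V -> R) (l : V -> \bar R) :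
  (forall n x, 0 <= a n x)%R ->
  (forall x n m, (n <= m)%N -> (a n x <= a m x)%R) ->
  (forall x, (a n x)%:E @[n --> \oo] --> l x) ->
  (\sum_(x <- exhaust n) a n x)%:E @[n --> \oo] --> \esum_(x in [set: V]) l x.
Proof.
move=> a0 a_mono al.
pose s n := (\sum_(x <- exhaust n) a n x)%:E.
have s_mono : {homo s : n m / (n <= m)%N >-> n <= m}.
  by move=> n m nm; rewrite lee_fin le_exhaust_sum// => x; exact: a_mono.
have al_le n x : (a n x)%:E <= l x.
  apply: cvge_to_ge (al x) _; near=> m; rewrite lee_fin a_mono//.
  by near: m; exact: nbhs_infty_ge.
suff <- : ereal_sup (range s) = \esum_(x in [set: V]) l x.
  exact: ereal_nondecreasing_cvgn.
apply/eqP; rewrite eq_le; apply/andP; split.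
  apply: ge_ereal_sup => _ [n _ <-]; apply: esum_ge.
  exists [set` exhaust n]; first by split=> //; exact: finite_seq.
  rewrite -fsbig_seq ?uniq_exhaust// /s -sumEFin.
  by apply: lee_sum => x _; exact: al_le.
apply: ge_ereal_sup => _ [A [finA _] <-].
have [N AN] := exhaust_finite_set finA.
have cvgA : (\sum_(x <- fset_set A) (a n x)%:E) @[n --> \oo] -->
    \sum_(x <- fset_set A) l x.
  by apply: cvg_nnesum => [x _|x _]; [by apply: nearW => n; rewrite lee_fin|exact: al].
rewrite fsbig_finite//; apply: cvge_to_le cvgA _; near=> n.
apply: (@le_trans _ _ (s n)); last by apply: ereal_sup_ubound; exists n.
rewrite -[leLHS](fsbig_finite _ _ finA) /s -sumEFin [leRHS]fsbig_seq ?uniq_exhaust//.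
apply: lee_fsum_nneg_subset => //.
  move=> x /set_mem Ax; rewrite inE /=.
  have := AN _ Ax; rewrite !mem_exhaust => /leq_trans; apply.
  by near: n; exact: nbhs_infty_ge.
by move=> x _; rewrite lee_fin.
Unshelve. all: by end_near. Qed.

End Exhaustion.

(** * The energy as an increasing limit of finite sums *)

Section Energy.
Context {R : realType} {V : countType} (G : weighted_graph R V) (s p : R).
Hypotheses (s_gt0 : 0 < s) (p_ge2 : 2 <= p).

Let p_gt0 : 0 < p. Proof. exact: lt_le_trans p_ge2. Qed.
Let p_neq0 : p != 0. Proof. by rewrite gt_eqF. Qed.
Let r_ge1 : 1 <= p / 2. Proof. by rewrite ler_pdivlMr// mul1r. Qed.
Let r_gt0 : 0 < p / 2. Proof. exact: lt_le_trans r_ge1. Qed.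

(** The empty set of vertices contributes the value 0 to the supremum, and the
    supremum of a set without upper bound is 0 by convention. *)
Lemma heat_kernel_ge0 t x y : 0 <= heat_kernel G t x y.
Proof.
rewrite /heat_kernel; set A := [set _ | _ in _].
have A0 : A 0 by exists fset0 => //; rewrite /dirichlet_heat_kernel in_fset0.
have [ubA|nubA] := pselect (has_ubound A); first exact: ub_le_sup ubA _ A0.
by rewrite sup_out// => -[].
Qed.

Lemma frac_weight_ge0 x y : (0 <= frac_weight G s x y)%E.
Proof.
have Gamma_ge0 : 0 <= Gamma (1 - s).
  apply: fine_ge0; apply: integral_ge0 => t _.
  by rewrite lee_fin mulr_ge0 ?powR_ge0 ?expR_ge0.
rewrite /frac_weight mule_ge0//.
  by rewrite lee_fin !mulr_ge0 ?(ltW (mu_gt0 G _)) ?(ltW s_gt0) ?invr_ge0.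
apply: integral_ge0 => t _.
by rewrite lee_fin mulr_ge0 ?heat_kernel_ge0 ?powR_ge0.
Qed.

Definition trunc_weight n x y : R := fine (mine (frac_weight G s x y) n%:R%:E).

Lemma trunc_weightE n x y :
  (trunc_weight n x y)%:E = mine (frac_weight G s x y) n%:R%:E.
Proof.
rewrite fineK// ge0_fin_numE.
  by apply: (@le_lt_trans _ _ n%:R%:E); rewrite ?ltry// ge_min lexx orbT.
by rewrite le_min frac_weight_ge0 lee_fin ler0n.
Qed.

Lemma trunc_weight_ge0 n x y : 0 <= trunc_weight n x y.
Proof.
by rewrite -lee_fin trunc_weightE le_min frac_weight_ge0 lee_fin ler0n.
Qed.

Lemma le_trunc_weight n m x y : (n <= m)%N ->
  trunc_weight n x y <= trunc_weight m x y.
Proof.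
move=> nm; rewrite -lee_fin !trunc_weightE le_min ge_min lexx /=.
by rewrite ge_min lee_fin ler_nat nm orbT.
Qed.

Lemma cvg_trunc_weight x y :
  (trunc_weight n x y)%:E @[n --> \oo] --> frac_weight G s x y.
Proof.
rewrite (_ : (fun _ => _) = (fun n => mine (frac_weight G s x y) n%:R%:E)); last first.
  by apply/funext => n; rewrite trunc_weightE.
have := frac_weight_ge0 x y; case: (frac_weight G s x y) => [a| |//] a0.
  apply: cvg_near_cst; near=> n; apply/min_idPl; rewrite lee_fin.
  by near: n; exact: nbhs_infty_ger.
rewrite (_ : (fun _ => _) = (fun n => n%:R%:E)); last first.
  by apply/funext => n; rewrite minye.
by apply/cvgeryP; exact: cvgr_idn.
Unshelve. all: by end_near. Qed.

Lemma cvg_trunc_weightM x y (d : R) :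
  (trunc_weight n x y * d)%:E @[n --> \oo] --> (frac_weight G s x y * d%:E)%E.
Proof.
by under eq_fun do rewrite EFinM; apply: cvgeZr => //; exact: cvg_trunc_weight.
Qed.

Definition partial_grad2 n (u : V -> R) x : R :=
  (2 * mu G x)^-1 * \sum_(y <- exhaust n) trunc_weight n x y * (u x - u y) ^+ 2.

Definition partial_energy n (u : V -> R) : R :=
  \sum_(x <- exhaust n)
    (partial_grad2 n u x `^ (p / 2) + (u x ^+ 2) `^ (p / 2)) * mu G x.

Let mu_ge0 x : 0 <= mu G x. Proof. exact: ltW (mu_gt0 G x). Qed.
Let mu2_ge0 x : 0 <= (2 * mu G x)^-1.
Proof. by rewrite invr_ge0 mulr_ge0. Qed.

Lemma partial_grad2_ge0 n u x : 0 <= partial_grad2 n u x.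
Proof.
by rewrite mulr_ge0// sumr_ge0// => y _; rewrite mulr_ge0 ?trunc_weight_ge0 ?sqr_ge0.
Qed.

Lemma partial_energy_ge0 n u : 0 <= partial_energy n u.
Proof. by apply: sumr_ge0 => x _; rewrite mulr_ge0// addr_ge0// powR_ge0. Qed.

Lemma le_partial_grad2 n m u x : (n <= m)%N ->
  partial_grad2 n u x <= partial_grad2 m u x.
Proof.
move=> nm; rewrite ler_wpM2l//; apply: le_exhaust_sum => // y.
  by rewrite ler_wpM2r ?sqr_ge0// le_trunc_weight.
by rewrite mulr_ge0 ?trunc_weight_ge0 ?sqr_ge0.
Qed.

Let energy_density n u x :=
  (partial_grad2 n u x `^ (p / 2) + (u x ^+ 2) `^ (p / 2)) * mu G x.

Let energy_density_ge0 n u x : 0 <= energy_density n u x.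
Proof. exact: mulr_ge0 (addr_ge0 (powR_ge0 _ _) (powR_ge0 _ _)) (mu_ge0 x). Qed.

Let le_energy_density n m u x : (n <= m)%N ->
  energy_density n u x <= energy_density m u x.
Proof.
move=> nm; apply: ler_wpM2r; first exact: mu_ge0.
rewrite lerD2r; apply: ge0_ler_powR; first exact: ltW r_gt0.
- exact: partial_grad2_ge0.
- exact: partial_grad2_ge0.
- exact: le_partial_grad2.
Qed.

Lemma le_partial_energy n m u : (n <= m)%N ->
  partial_energy n u <= partial_energy m u.
Proof.
move=> nm; apply: (le_exhaust_sum nm) => x; first exact: le_energy_density.
exact: energy_density_ge0.
Qed.

Local Open Scope ereal_scope.

Lemma cvg_partial_grad2 u x : (partial_grad2 n u x)%:E @[n --> \oo] -->
  (2 * mu G x)^-1%:E *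
    \esum_(y in [set y | y != x]) (frac_weight G s x y * ((u x - u y) ^+ 2)%:E).
Proof.
rewrite esum_mkcond.
rewrite (_ : (fun _ => _) = (fun n => (2 * mu G x)^-1%:E *
    (\sum_(y <- exhaust n) trunc_weight n x y * (u x - u y) ^+ 2)%:E)); last first.
  by apply/funext => n; rewrite -EFinM.
apply: cvgeZl => //; apply: cvg_exhaust_esum => [n y|y n m nm|y].
- by rewrite mulr_ge0 ?trunc_weight_ge0 ?sqr_ge0.
- by rewrite ler_wpM2r ?sqr_ge0// le_trunc_weight.
- case: ifPn => [_|]; first exact: cvg_trunc_weightM.
  rewrite notin_setE /= => /negP; rewrite negbK => /eqP ->.
  rewrite subrr expr0n /=; under eq_fun do rewrite mulr0; exact: cvg_cst.
Qed.

Lemma cvg_partial_energy u :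
  (partial_energy n u)%:E @[n --> \oo] --> sobolev_energy G s p u.
Proof.
apply: cvg_exhaust_esum => [||x].
- by move=> n x; exact: energy_density_ge0.
- by move=> x n m; exact: le_energy_density.
under eq_fun do rewrite EFinM EFinD.
apply: cvgeZr => //; apply: cvgeD.
- by rewrite ge0_adde_def// inE ?poweR_ge0// lee_fin powR_ge0.
- under eq_fun do rewrite -poweR_EFin.
  rewrite /frac_grad -poweRrM (mulrC 2^-1)%R.
  apply: cvg_poweR_ge0 => [//|n|]; first by rewrite lee_fin partial_grad2_ge0.
  exact: cvg_partial_grad2.
- have -> : (`|u x| `^ p)%R = (((u x) ^+ 2) `^ (p / 2))%R.
    by rewrite -real_normK ?num_real// -powR_mulrn// -powRrM mulrC divfK.
  exact: cvg_cst.
Qed.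

Lemma sobolev_energy_leP u (c : R) :
  sobolev_energy G s p u <= c%:E <-> forall n, (partial_energy n u <= c)%R.
Proof.
split=> [uc n|uc]; last first.
  apply: cvge_to_le (@cvg_partial_energy u) _.
  by apply: nearW => n; rewrite lee_fin.
rewrite -lee_fin; apply: le_trans uc.
apply: cvge_to_ge (@cvg_partial_energy u) _; near=> m.
rewrite lee_fin le_partial_energy//; near: m; exact: nbhs_infty_ge.
Unshelve. all: by end_near. Qed.


Local Open Scope ring_scope.

(** The square is convex, hence so is [partial_grad2], and [powR] with exponent
    [p / 2] is convex and nondecreasing. *)
Lemma partial_energy_conv n t (u v : V -> R^o) : 0 <= t <= 1 ->
  partial_energy n (t *: u + (1 - t) *: v) <=
  t * partial_energy n u + (1 - t) * partial_energy n v.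
Proof.
move=> t01; have /andP[t0 t1] := t01.
have sqr_conv (a b : R) :
    (t * a + (1 - t) * b) ^+ 2 <= t * a ^+ 2 + (1 - t) * b ^+ 2.
  rewrite -subr_ge0 [X in 0 <= X](_ : _ = t * (1 - t) * (a - b) ^+ 2); last by ring.
  by rewrite mulr_ge0 ?sqr_ge0 ?mulr_ge0 ?subr_ge0.
rewrite !mulr_sumr -big_split /=; apply: ler_sum => x _.
rewrite !mulrA -mulrDl ler_wpM2r//.
rewrite !mulrDr addrACA lerD//; apply: powR_le_conv => //;
  rewrite ?partial_grad2_ge0 ?sqr_ge0//; last exact: sqr_conv.
rewrite /partial_grad2 !(mulrCA _ (2 * mu G x)^-1) -mulrDr ler_wpM2l//.
rewrite !mulr_sumr -big_split /=; apply: ler_sum => y _.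
rewrite !(mulrCA _ (trunc_weight n x y)) -mulrDr ler_wpM2l ?trunc_weight_ge0//.
rewrite [X in X ^+ 2](_ : _ = t * (u x - u y) + (1 - t) * (v x - v y)); last first.
  change (t * u x + (1 - t) * v x - (t * u y + (1 - t) * v y) =
    t * (u x - u y) + (1 - t) * (v x - v y)); ring.
exact: sqr_conv.
Qed.

Lemma partial_energyZ n a (u : V -> R^o) :
  partial_energy n (a *: u) = `|a| `^ p * partial_energy n u.
Proof.
have absp : `|a| `^ p = (a ^+ 2) `^ (p / 2).
  by rewrite -real_normK ?num_real// -powR_mulrn// -powRrM mulrC divfK.
rewrite mulr_sumr; apply: eq_bigr => x _.
rewrite mulrA mulrDr; congr ((_ + _) * _); rewrite absp -powRM ?sqr_ge0//.
- congr (_ `^ _); rewrite /partial_grad2 mulrCA; congr (_ * _).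
  rewrite mulr_sumr; apply: eq_bigr => y _; rewrite [RHS]mulrCA; congr (_ * _).
  change ((a * u x - a * u y) ^+ 2 = a ^+ 2 * (u x - u y) ^+ 2); ring.
- exact: partial_grad2_ge0.
- by congr (_ `^ _); rewrite -exprMn.
Qed.

Lemma partial_energy_clarkson n (u v : V -> R^o) :
  partial_energy n (2^-1 *: (u + v)) + partial_energy n (2^-1 *: (u - v)) <=
  2^-1 * (partial_energy n u + partial_energy n v).
Proof.
(* The density of the energy has a gradient part and a part from the values;
   each satisfies the inequality. *)
have combine (m a b c d a' b' c' d' : R) : 0 <= m ->
    a + b <= 2^-1 * (c + d) -> a' + b' <= 2^-1 * (c' + d') ->
    (a + a') * m + (b + b') * m <= 2^-1 * ((c + c') * m + (d + d') * m).
  move=> m0 H H'; rewrite -subr_ge0.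
  rewrite [leRHS](_ : _ = (2^-1 * (c + d) - (a + b) +
    (2^-1 * (c' + d') - (a' + b'))) * m); last by ring.
  by apply: mulr_ge0 => //; lra.
rewrite -!big_split mulr_sumr; apply: ler_sum => x _.
apply: combine; first exact: mu_ge0.
  apply: (powR_midpoint r_ge1); try exact: partial_grad2_ge0.
  rewrite /partial_grad2 -!mulrDr mulrCA; congr (_ * _).
  rewrite -!big_split mulr_sumr; apply: eq_bigr => y _.
  change (trunc_weight n x y * (2^-1 * (u x + v x) - 2^-1 * (u y + v y)) ^+ 2 +
   trunc_weight n x y * (2^-1 * (u x - v x) - 2^-1 * (u y - v y)) ^+ 2 =
   2^-1 * (trunc_weight n x y * (u x - u y) ^+ 2 + trunc_weight n x y * (v x - v y) ^+ 2)).
  by field.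
apply: (powR_midpoint r_ge1); try exact: sqr_ge0.
change ((2^-1 * (u x + v x)) ^+ 2 + (2^-1 * (u x - v x)) ^+ 2 =
  2^-1 * (u x ^+ 2 + v x ^+ 2)).
by field.
Qed.

Lemma partial_energy_contraction n (u v : V -> R) :
  (forall x, `|u x| <= `|v x|) -> (forall x y, `|u x - u y| <= `|v x - v y|) ->
  partial_energy n u <= partial_energy n v.
Proof.
move=> uv0 uv.
have sqr_le (a b : R) : `|a| <= `|b| -> a ^+ 2 <= b ^+ 2.
  by move=> ab; rewrite -(real_normK (num_real a)) -(real_normK (num_real b)) lerXn2r.
apply: ler_sum => x _; rewrite ler_wpM2r// lerD// ge0_ler_powR ?nnegrE
  ?partial_grad2_ge0 ?sqr_ge0 ?sqr_le ?(ltW r_gt0)//.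
rewrite ler_wpM2l//; apply: ler_sum => y _.
by rewrite ler_wpM2l ?trunc_weight_ge0// sqr_le.
Qed.

Lemma cvg_partial_energy_pointwise n (T : Type) (F : set_system T)
    (w : T -> V -> R) (v : V -> R) : Filter F ->
  (forall x, w t x @[t --> F] --> v x) ->
  partial_energy n (w t) @[t --> F] --> partial_energy n v.
Proof.
move=> FF wv.
have sqr_cvg (f : T -> R) (a : R) : f t @[t --> F] --> a ->
    f t ^+ 2 @[t --> F] --> a ^+ 2.
  by move=> fa; rewrite expr2; under eq_fun do rewrite expr2; exact: cvgM.
apply: cvg_big => [|x _]; first exact: add_continuous.
apply: cvgM; last exact: cvg_cst.
apply: cvgD; (apply: cvg_powR_ge0; first exact: r_gt0).
- by move=> t; exact: partial_grad2_ge0.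
- exact: partial_grad2_ge0.
- apply: cvgM; first exact: cvg_cst.
  apply: cvg_big => [|y _]; first exact: add_continuous.
  apply: cvgM; first exact: cvg_cst.
  by apply: sqr_cvg; apply: cvgB; exact: wv.
- by move=> t; exact: sqr_ge0.
- exact: sqr_ge0.
- by apply: sqr_cvg; exact: wv.
Qed.

Lemma le_eval_partial_energy n (u : V -> R) x : (choice.pickle x < n)%N ->
  `|u x| `^ p * mu G x <= partial_energy n u.
Proof.
move=> xn; rewrite /partial_energy (big_rem x) ?mem_exhaust//=.
rewrite ler_wpDr ?sumr_ge0// => [y _|]; first by rewrite mulr_ge0 ?addr_ge0 ?powR_ge0.
rewrite ler_wpM2r// ler_wpDl ?powR_ge0//.
by rewrite -[u x ^+ 2]real_normK ?num_real// -powR_mulrn// -powRrM mulrC divfK.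
Qed.


Local Open Scope ereal_scope.

Lemma sobolev_energy_ge0 u : 0 <= sobolev_energy G s p u.
Proof.
apply: cvge_to_ge (@cvg_partial_energy u) _.
by apply: nearW => n; rewrite lee_fin partial_energy_ge0.
Qed.

Lemma sobolev_norm_ge0 u : 0 <= sobolev_norm G s p u.
Proof. exact: poweR_ge0. Qed.

Lemma sobolev_norm_poweR u : sobolev_norm G s p u `^ p = sobolev_energy G s p u.
Proof. by rewrite -poweRrM mulVf// poweRe1// sobolev_energy_ge0. Qed.

Lemma sobolev_norm_leP u (c : R) : (0 <= c)%R ->
  sobolev_norm G s p u <= c%:E <-> forall n, (partial_energy n u <= c `^ p)%R.
Proof.
move=> c0; apply: iff_trans (sobolev_energy_leP u (c `^ p)).
have in_itvE (x : \bar R) : 0 <= x -> x \in `[0, +oo].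
  by move=> x0; rewrite in_itv /= x0 leey.
split=> [uc|uc].
  rewrite -sobolev_norm_poweR -poweR_EFin; apply: gt0_ler_poweR => //.
  - exact: ltW.
  - exact: in_itvE (sobolev_norm_ge0 u).
  - exact: in_itvE.
have -> : c%:E = (c `^ p)%:E `^ p^-1.
  by rewrite poweR_EFin -powRrM mulfV// powRr1.
apply: gt0_ler_poweR => //; first by rewrite invr_ge0 ltW.
- exact: in_itvE (sobolev_energy_ge0 u).
- by apply: in_itvE; rewrite lee_fin powR_ge0.
Qed.

Lemma sobolev_energy_lty u :
  (sobolev_energy G s p u < +oo) = (sobolev_norm G s p u < +oo).
Proof.
apply/idP/idP => [|uy]; first exact: poweR_lty.
by rewrite -sobolev_norm_poweR poweR_lty.
Qed.

(** The norm is the gauge of the convex set of functions of energy at most 1: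
    for [N u <= a] and [N v <= b], the function [(u + v) / (a + b)] is the convex
    combination of [u / a] and [v / b] with coefficients [a / (a + b)] and
    [b / (a + b)]. *)
Lemma sobolev_normD (u v : V -> R^o) :
  sobolev_norm G s p (u + v)%R <= sobolev_norm G s p u + sobolev_norm G s p v.
Proof.
(* The division by a and b asks for strict upper bounds of possibly zero norms;
   an arbitrarily small amount is added to both at the end. *)
have normD_pos (a b : R) : (0 < a)%R -> (0 < b)%R ->
    sobolev_norm G s p u <= a%:E -> sobolev_norm G s p v <= b%:E ->
    sobolev_norm G s p (u + v)%R <= (a + b)%:E.
  move=> a0 b0 /(sobolev_norm_leP _ (ltW a0)) ua /(sobolev_norm_leP _ (ltW b0)) vb.
  have ab0 : (0 < a + b)%R by exact: addr_gt0.
  apply/sobolev_norm_leP => [|n]; first exact: ltW.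
  pose t := (a / (a + b))%R.
  have tE : (1 - t = b / (a + b))%R by rewrite /t; field; rewrite gt_eqF.
  have t01 : (0 <= t <= 1)%R.
    rewrite divr_ge0 ?(ltW a0) ?(ltW ab0)//= -subr_ge0 tE.
    by rewrite divr_ge0 ?(ltW b0) ?(ltW ab0).
  have -> : (u + v = (a + b) *: (t *: (a^-1 *: u) + (1 - t) *: (b^-1 *: v)))%R.
    rewrite tE scalerDr !scalerA.
    have -> : ((a + b) * t * a^-1 = 1)%R.
      by rewrite /t; field; rewrite !gt_eqF.
    have -> : ((a + b) * (b / (a + b)) * b^-1 = 1)%R.
      by field; rewrite !gt_eqF.
    by rewrite !scale1r.
  have unit_ball (c : R) (w : V -> R^o) : (0 < c)%R ->
      (partial_energy n w <= c `^ p)%R -> (partial_energy n (c^-1 *: w) <= 1)%R.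
    move=> c0 wc; rewrite partial_energyZ normfV gtr0_norm//.
    have cp0 : (0 < c `^ p)%R by exact: powR_gt0.
    have -> : (c^-1 `^ p = (c `^ p)^-1)%R.
      by rewrite -powR_inv1 ?(ltW c0)// -powRrM mulN1r powRN.
    by rewrite mulrC ler_pdivrMr ?mul1r.
  rewrite partial_energyZ gtr0_norm// -[leRHS]mulr1.
  apply: ler_wpM2l; first exact: powR_ge0.
  apply: le_trans (partial_energy_conv _ _ _ t01) _.
  have := unit_ball _ _ a0 (ua n); have := unit_ball _ _ b0 (vb n).
  move: t01 => /andP[t0 t1] hb ha.
  apply: (@le_trans _ _ (t * 1 + (1 - t) * 1)%R); last by lra.
  by apply: lerD; apply: ler_wpM2l => //; rewrite subr_ge0.
have [->|uoo] := eqVneq (sobolev_norm G s p u) +oo.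
  by rewrite addye ?leey// gt_eqF// (lt_le_trans _ (sobolev_norm_ge0 v))// ltNyr.
have [->|voo] := eqVneq (sobolev_norm G s p v) +oo.
  by rewrite addey ?leey// gt_eqF// (lt_le_trans _ (sobolev_norm_ge0 u))// ltNyr.
have finE w : sobolev_norm G s p w != +oo ->
    sobolev_norm G s p w = (fine (sobolev_norm G s p w))%:E.
  by move=> woo; rewrite fineK// ge0_fin_numE ?sobolev_norm_ge0// ltey.
have := sobolev_norm_ge0 u; have := sobolev_norm_ge0 v.
move: normD_pos; rewrite (finE _ uoo) (finE _ voo).
move: (fine (sobolev_norm G s p u)) (fine (sobolev_norm G s p v)) => a b.
rewrite !lee_fin => normD_pos b0 a0; apply/lee_addgt0Pr => e e0; rewrite -!EFinD.
have -> : (a + b + e = (a + e / 2) + (b + e / 2))%R by lra.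
by apply: normD_pos; rewrite ?lee_fin; lra.
Qed.

Lemma sobolev_energyZ a (u : V -> R^o) :
  sobolev_energy G s p (a *: u)%R = (`|a| `^ p)%:E * sobolev_energy G s p u.
Proof.
have cvgZ : (partial_energy n (a *: u)%R)%:E @[n --> \oo] -->
    (`|a| `^ p)%:E * sobolev_energy G s p u.
  under eq_fun do rewrite partial_energyZ EFinM.
  by apply: cvgeZl => //; exact: cvg_partial_energy.
exact: cvg_unique (@cvg_partial_energy _) cvgZ.
Qed.

Lemma sobolev_normZ a (u : V -> R^o) :
  sobolev_norm G s p (a *: u)%R = `|a|%:E * sobolev_norm G s p u.
Proof.
rewrite /sobolev_norm sobolev_energyZ poweRM ?lee_fin ?powR_ge0 ?sobolev_energy_ge0//.
by rewrite poweR_EFin -powRrM mulfV// powRr1.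
Qed.

Lemma sobolev_energy_clarkson (u v : V -> R^o) :
  sobolev_energy G s p (2^-1 *: (u + v))%R + sobolev_energy G s p (2^-1 *: (u - v))%R
  <= 2^-1%:E * (sobolev_energy G s p u + sobolev_energy G s p v).
Proof.
have def a b : sobolev_energy G s p a +? sobolev_energy G s p b.
  by rewrite ge0_adde_def// inE sobolev_energy_ge0.
have lhs : (partial_energy n (2^-1 *: (u + v))%R)%:E +
    (partial_energy n (2^-1 *: (u - v))%R)%:E @[n --> \oo] -->
    sobolev_energy G s p (2^-1 *: (u + v))%R + sobolev_energy G s p (2^-1 *: (u - v))%R.
  by apply: cvgeD; [exact: def|exact: cvg_partial_energy|exact: cvg_partial_energy].
have rhs : 2^-1%:E * ((partial_energy n u)%:E + (partial_energy n v)%:E)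
    @[n --> \oo] --> 2^-1%:E * (sobolev_energy G s p u + sobolev_energy G s p v).
  apply: cvgeZl; first by [].
  by apply: cvgeD; [exact: def|exact: cvg_partial_energy|exact: cvg_partial_energy].
apply: lee_cvg_to lhs rhs _; apply: nearW => n.
by rewrite -!EFinD -EFinM lee_fin partial_energy_clarkson.
Qed.

Lemma sobolev_norm_contraction (u v : V -> R) :
  (forall x, `|u x| <= `|v x|)%R -> (forall x y, `|u x - u y| <= `|v x - v y|)%R ->
  sobolev_norm G s p u <= sobolev_norm G s p v.
Proof.
move=> uv0 uv; have := sobolev_norm_ge0 v.
case vE : (sobolev_norm G s p v) => [c| |]; rewrite ?leey// => c0.
apply/sobolev_norm_leP => [//|n]; apply: le_trans (partial_energy_contraction _ uv0 uv) _.
by move: n; apply/sobolev_norm_leP => //; rewrite vE.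
Qed.

(** Each finite sum is continuous for pointwise convergence, and a supremum of
    continuous functions is lower semicontinuous. *)
Lemma sobolev_norm_fatou (T : Type) (F : set_system T) (w : T -> V -> R)
    (v : V -> R) (c : \bar R) : ProperFilter F ->
  (forall x, (w t x) @[t --> F] --> v x) ->
  (\forall t \near F, sobolev_norm G s p (w t) <= c) -> sobolev_norm G s p v <= c.
Proof.
move=> FF wv Fc; have [t0 Ht0] := filter_ex Fc.
have := le_trans (sobolev_norm_ge0 _) Ht0.
case: c Fc {Ht0} => [c| |//] Fc c0; last exact: leey.
apply/sobolev_norm_leP => [//|n].
apply: cvgr_to_le (@cvg_partial_energy_pointwise n T F w v _ wv) _.
apply: filterS Fc => t Ht; exact: (sobolev_norm_leP (w t) c0).1.
Qed.

(** The term [`|u x| `^ p * mu G x] is part of the energy. *)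
Lemma sobolev_norm_eval (m : R) x (u : V -> R) : (0 < m)%R -> (m <= mu G x)%R ->
  `|u x|%:E <= (m^-1 `^ p^-1)%:E * sobolev_norm G s p u.
Proof.
move=> m0 mx; have C0 : (0 < m^-1 `^ p^-1)%R by rewrite powR_gt0// invr_gt0.
have := sobolev_norm_ge0 u; case uE : (sobolev_norm G s p u) => [c| |//]; last first.
  by rewrite gt0_muley ?lte_fin ?leey.
rewrite lee_fin => c0; rewrite -EFinM lee_fin.
have /sobolev_norm_leP-/(_ c0 (choice.pickle x).+1) uc :
  sobolev_norm G s p u <= c%:E by rewrite uE.
have {}uc := le_trans (le_eval_partial_energy u (ltnSn _)) uc.
have : (`|u x| `^ p <= m^-1 * c `^ p)%R.
  rewrite mulrC ler_pdivlMr//; apply: le_trans uc.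
  by apply: ler_wpM2l => //; exact: powR_ge0.
have -> : (m^-1 * c `^ p = (m^-1 `^ p^-1 * c) `^ p)%R.
  by rewrite powRM ?powR_ge0// -powRrM mulVf// powRr1// invr_ge0 ltW.
move=> H; rewrite leNgt; apply/negP => Hlt; move: H; rewrite leNgt => /negP; apply.
apply: gt0_ltr_powR => //; rewrite nnegrE//.
by apply: mulr_ge0 => //; exact: ltW.
Qed.

End Energy.

(** * The closure of the finitely supported functions *)

Section Sobolev0.
Context {R : realType} {V : countType} (G : weighted_graph R V) (s p : R).
Hypotheses (s_gt0 : 0 < s) (p_ge2 : 2 <= p) (mu_inf : 0 < inf (range (mu G))).

Let p_gt0 : 0 < p. Proof. exact: lt_le_trans p_ge2. Qed.
Let N u := sobolev_norm G s p u.
Let normD := @sobolev_normD R V G s p s_gt0 p_ge2.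
Let normZ := @sobolev_normZ R V G s p s_gt0 p_ge2.
Let norm_ge0 := @sobolev_norm_ge0 R V G s p.

Lemma inf_mu_le x : inf (range (mu G)) <= mu G x.
Proof.
apply: ge_inf; last by exists x.
by exists 0 => _ [y _ <-]; exact: ltW (mu_gt0 G y).
Qed.

Lemma sobolev_norm_eval_unif : exists C : R, forall x (u : V -> R),
  (`|u x|%:E <= C%:E * sobolev_norm G s p u)%E.
Proof.
exists ((inf (range (mu G)))^-1 `^ p^-1) => x u.
by apply: sobolev_norm_eval => //; exact: inf_mu_le.
Qed.

(** A bound on the norm bounds the function. *)
Lemma sobolevP (u : V -> R) : sobolev G s p u <-> (sobolev_norm G s p u < +oo)%E.
Proof.
rewrite -sobolev_energy_lty//; split=> [[//]|uy]; split=> //.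
have [C HC] := sobolev_norm_eval_unif.
have Nu : N u \is a fin_num by rewrite ge0_fin_numE// -sobolev_energy_lty.
apply: filterS (nbhs_pinfty_ge (num_real (C * fine (N u)))) => M HM x _ /=.
by apply: le_trans HM; rewrite -lee_fin EFinM fineK.
Qed.

Lemma finitely_supported_comb (a b : R) (phi psi : V -> R^o) :
  finitely_supported phi -> finitely_supported psi ->
  finitely_supported (a *: phi + b *: psi).
Proof.
move=> fphi fpsi.
have fU : finite_set ([set x | phi x != 0] `|` [set x | psi x != 0]).
  by rewrite finite_setU; split.
apply: sub_finite_set fU => x /= xneq0.
have [phi0|] := eqVneq (phi x) 0; last by left.
right; apply: contraNneq xneq0 => psi0; apply/eqP.
by change (a * phi x + b * psi x = 0); rewrite phi0 psi0 !mulr0 addr0.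
Qed.

Lemma sobolev0_submod : submod_closed (mem (sobolev0 G s p) : {pred (V -> R^o)}).
Proof.
have norm00 : N (0 : V -> R^o) = 0%E by rewrite /N -(scale0r 0) normZ normr0 mul0e.
split=> [|a u v /set_mem Su /set_mem Sv]; apply/mem_set.
  split; first by apply/sobolevP; rewrite [ltLHS]norm00 ltry.
  move=> e e0; exists (0 : V -> R^o).
    by apply: sub_finite_set (finite_set0 V) => x /=; rewrite eqxx.
  by rewrite [X in sobolev_norm _ _ _ X](subr0 (0 : V -> R^o)) [ltLHS]norm00 lte_fin.
move: Su Sv => [/sobolevP uy Hu] [/sobolevP vy Hv]; split.
  apply/sobolevP; apply: le_lt_trans (normD _ _) _; rewrite normZ.
  apply: lte_add_pinfty vy.
  have ufin : sobolev_norm G s p u \is a fin_num.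
    rewrite ge0_fin_numE; [exact: uy|exact: norm_ge0].
  by rewrite -(fineK ufin) -EFinM ltry.
move=> e e0; pose b := `|a| + 1.
have b0 : 0 < b by rewrite ltr_wpDl.
have eb0 : 0 < e / 2 / b by rewrite !divr_gt0.
have e20 : 0 < e / 2 by rewrite divr_gt0.
have [phi fphi uphi] := Hu _ eb0; have [psi fpsi vpsi] := Hv _ e20.
exists (a *: (phi : V -> R^o) + psi).
  by rewrite -[X in _ + X]scale1r; exact: finitely_supported_comb.
rewrite [X in sobolev_norm _ _ _ X]
  (_ : _ = a *: (u - phi : V -> R^o) + (v - psi : V -> R^o)); last first.
  by apply/funext => x; change (a * u x + v x - (a * phi x + psi x) =
    a * (u x - phi x) + (v x - psi x)); ring.
apply: le_lt_trans (normD _ _) _; rewrite [e]splitr EFinD; apply: lteD vpsi; rewrite normZ.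
apply: (@le_lt_trans _ _ (`|a|%:E * (e / 2 / b)%:E)%E).
  by apply: lee_pmul; [exact: normr_ge0|exact: norm_ge0|exact: lexx|exact: ltW uphi].
rewrite -EFinM lte_fin -[ltRHS](divfK (lt0r_neq0 b0)) mulrC.
by rewrite ltr_pM2l// ltrDl.
Qed.

Lemma sobolev0_closed (v : V -> R^o) :
  (forall e : R, 0 < e -> exists2 u : V -> R^o, sobolev0 G s p u &
    (sobolev_norm G s p (v - u)%R <= e%:E)%E) ->
  sobolev0 G s p v.
Proof.
move=> Hv; split.
  have [u [/sobolevP uy _] vu] := Hv 1 ltr01.
  apply/sobolevP; have := normD u (v - u); rewrite addrC subrK => /le_lt_trans; apply.
  by apply: (lte_add_pinfty uy); exact: le_lt_trans vu (ltry _).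
move=> e e0; have e20 : 0 < e / 2 by rewrite divr_gt0.
have [u [_ Hu] vu] := Hv _ e20; have [phi fphi uphi] := Hu _ e20.
exists phi => //.
rewrite [X in sobolev_norm _ _ _ X](_ : _ = (v - u) + (u - phi : V -> R^o)); last first.
  by rewrite addrA subrK.
apply: le_lt_trans (normD _ _) _.
have vu_fin : sobolev_norm G s p (v - u) \is a fin_num.
  by rewrite ge0_fin_numE; [exact: le_lt_trans vu (ltry _)|exact: norm_ge0].
by rewrite [e]splitr EFinD; exact: lee_ltD.
Qed.

Definition sobolev0_space : function_space R V.
Proof.
refine (@FunctionSpace R V (sobolev_norm G s p) (sobolev0 G s p)
  (@norm_ge0) (@normD) (@normZ) _ _ _ sobolev0_submod sobolev0_closed).
- by move=> x; have [C HC] := sobolev_norm_eval_unif; exists C => u; exact: HC.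
- move=> F v c FF; exact: (@sobolev_norm_fatou _ _ _ _ _ s_gt0 p_ge2 _ F id v c FF).
- by move=> u [/sobolevP].
Defined.

Theorem sobolev0_reflexive_banach :
  reflexive_banach (sobolev0 G s p) (sobolev_norm G s p).
Proof.
apply: (@clarkson_reflexive_banach R V sobolev0_space p p_gt0) => u v.
change (N (2^-1 *: (u + v))%R `^ p + N (2^-1 *: (u - v))%R `^ p <=
  2^-1%:E * (N u `^ p + N v `^ p))%E.
have NE w : (N w `^ p)%E = sobolev_energy G s p w by exact: sobolev_norm_poweR.
rewrite !NE; exact: sobolev_energy_clarkson.
Qed.


(** Let [C n] be the set of finitely supported [psi] of norm at most [M] with
    [`|psi - v| <= 1 / (n + 1)] on the first [n] vertices.  These sets are stable
    under midpoints and decrease, so the infima [I n] of the energy on them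
    increase to a finite limit.  Choose [psi k] in [C k] with energy close to
    [I k].  For [n] large and [n <= k], the midpoint of [psi n] and [psi k] is in
    [C n], so its energy is not much smaller than theirs, and Clarkson's
    inequality makes the norm of [psi k - psi n] small.  Let [k] tend to infinity:
    [psi k] tends to [v] pointwise, so [psi n] approximates [v] in norm by lower
    semicontinuity. *)
Lemma sobolev0_bounded_pointwise (w : nat -> V -> R) (v : V -> R) (M : R) :
  (forall k, finitely_supported (w k)) ->
  (forall k, (sobolev_norm G s p (w k) <= M%:E)%E) ->
  (forall x, w k x @[k --> \oo] --> v x) ->
  sobolev0 G s p v.
Proof.
have arith (a b c f t i d : R) : a < t + d -> b < t + d -> i <= c ->
    t - d < i -> c + f <= 2^-1 * (a + b) -> f <= 2 * d by lra.
move=> fw wM wv.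
have vM : (sobolev_norm G s p v <= M%:E)%E.
  by apply: (@sobolev_norm_fatou _ _ _ _ _ s_gt0 p_ge2 _ \oo w v M%:E _ wv); exact: nearW.
have M0 : 0 <= M by rewrite -lee_fin; exact: le_trans (norm_ge0 _) vM.
split; first by apply/sobolevP; exact: le_lt_trans vM (ltry _).
move=> e e0.
pose C n := [set psi : V -> R^o | [/\ finitely_supported psi,
  (sobolev_norm G s p psi <= M%:E)%E &
  forall x, x \in exhaust n -> `|psi x - v x| <= n.+1%:R^-1]].
pose E u := fine (sobolev_energy G s p u).
have E_leP u : (sobolev_norm G s p u <= M%:E)%E ->
    sobolev_energy G s p u = (E u)%:E.
  move=> uM; rewrite fineK// ge0_fin_numE; last exact: sobolev_energy_ge0.
  by rewrite (sobolev_energy_lty _ s_gt0 p_ge2); exact: le_lt_trans uM (ltry _).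
have E_ge0 u : 0 <= E u by apply: fine_ge0; exact: sobolev_energy_ge0.
have C_neq0 n : C n !=set0.
  have : \forall k \near \oo, forall x, x \in exhaust n -> `|w k x - v x| <= n.+1%:R^-1.
    apply: near_all_seq => x; have n0 : 0 < n.+1%:R^-1 :> R by rewrite invr_gt0.
    by move/cvgr_distC_le : (wv x) => /(_ _ n0).
  by move=> /filter_ex[k Hk]; exists (w k); split.
have C_mono n m : (n <= m)%N -> C m `<=` C n.
  move=> nm psi [fpsi psiM psiv]; split=> // x xn.
  have xm : x \in exhaust m by move: xn; rewrite !mem_exhaust => /leq_trans; apply.
  apply: (le_trans (psiv _ xm)).
  by rewrite lef_pV2 ?posrE// ler_nat.
have normhalf (phi psi : V -> R^o) : (N phi <= M%:E)%E -> (N psi <= M%:E)%E ->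
    (N (2^-1 *: (phi + psi))%R <= M%:E)%E.
  move=> phiM psiM; rewrite /N normZ ger0_norm//.
  apply: (@le_trans _ _ (2^-1%:E * (M%:E + M%:E))%E).
    apply: lee_wpmul2l; first by rewrite lee_fin.
    exact: le_trans (normD _ _) (leeD phiM psiM).
  by rewrite -EFinD -EFinM lee_fin; lra.
have C_mid n phi psi : C n phi -> C n psi -> C n (2^-1 *: (phi + psi)).
  move=> [fphi phiM phiv] [fpsi psiM psiv]; split.
  - by rewrite scalerDr; exact: finitely_supported_comb.
  - exact: normhalf.
  - move=> x xn; change (`|2^-1 * (phi x + psi x) - v x| <= n.+1%:R^-1).
    have -> : 2^-1 * (phi x + psi x) - v x = (phi x - v x) / 2 + (psi x - v x) / 2.
      by field.
    apply: (le_trans (ler_normD _ _)); rewrite [leRHS]splitr !normrM.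
    have -> : `|2^-1| = 2^-1 :> R by rewrite ger0_norm.
    by apply: lerD; (apply: ler_wpM2r => //); [exact: phiv|exact: psiv].
pose I n := inf [set E psi | psi in C n].
have I_le n psi : C n psi -> I n <= E psi.
  move=> Cpsi; apply: ge_inf; last by exists psi.
  by exists 0 => _ [phi _ <-]; exact: E_ge0.
have has_inf_C n : has_inf [set E psi | psi in C n].
  split; first by have [psi Cpsi] := C_neq0 n; exists (E psi), psi.
  by exists 0 => _ [phi _ <-]; exact: E_ge0.
have I_ub n : I n <= M `^ p.
  have [psi Cpsi] := C_neq0 n; apply: (le_trans (I_le _ _ Cpsi)).
  have [_ psiM _] := Cpsi; rewrite -lee_fin -(E_leP _ psiM).
  apply/(sobolev_energy_leP _ s_gt0 p_ge2) => k.
  by move: k; apply/(sobolev_norm_leP _ s_gt0 p_ge2).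
have I_sup : has_sup (range I).
  by split; [exists (I 0%N), 0%N|exists (M `^ p) => _ [n _ <-]].
(* With this d, Clarkson's inequality gives energy at most (e / 4) `^ p, that is
   norm at most e / 4, to the half-difference, and norm at most e / 2 to the
   difference itself. *)
pose d := (e / 4) `^ p / 2.
have d0 : 0 < d by rewrite divr_gt0// powR_gt0// divr_gt0.
have [_ [n _ <-] In] := sup_adherent d0 I_sup.
have psi_ex k : exists psi, C k psi /\ E psi < I k + d.
  have [_ [psi Cpsi <-] Epsi] := inf_adherent d0 (has_inf_C k).
  by exists psi.
pose psi k := projT1 (cid (psi_ex k)).
have psiC k : C k (psi k) by rewrite /psi; case: cid => ? [].
have psiE k : E (psi k) < sup (range I) + d.
  have Ek : E (psi k) < I k + d by rewrite /psi; case: cid => ? [].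
  apply: (lt_le_trans Ek); rewrite lerD2r; apply: ub_le_sup I_sup.2 _ _.
  by exists k.
have psi_close k : (n <= k)%N ->
    (sobolev_norm G s p (psi k - psi n)%R <= (e / 2)%:E)%E.
  move=> nk; have Ck := C_mono _ _ nk _ (psiC k).
  have Emid := I_le _ _ (C_mid _ _ _ Ck (psiC n)).
  have [_ nM _] := psiC n; have [_ kM _] := Ck.
  have nNM : (N (- psi n)%R <= M%:E)%E by rewrite /N -scaleN1r normZ normrN1 mul1e.
  have := sobolev_energy_clarkson G s_gt0 p_ge2 (psi k) (psi n).
  rewrite (E_leP _ kM) (E_leP _ nM) (E_leP _ (normhalf _ _ kM nM)).
  rewrite (E_leP _ (normhalf _ _ kM nNM)) -!EFinD -EFinM lee_fin => clk.
  have Ediff : E (2^-1 *: (psi k - psi n)) <= (e / 4) `^ p.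
    have -> : (e / 4) `^ p = 2 * d by rewrite /d; field.
    exact: arith (psiE k) (psiE n) Emid In clk.
  have : (N (2^-1 *: (psi k - psi n))%R <= (e / 4)%:E)%E.
    apply/(sobolev_norm_leP _ s_gt0 p_ge2); first by rewrite divr_ge0// ltW.
    apply/(sobolev_energy_leP _ s_gt0 p_ge2).
    by rewrite (E_leP _ (normhalf _ _ kM nNM)) lee_fin.
  rewrite /N normZ ger0_norm// => H.
  have -> : (e / 2)%:E = (2%:E * (e / 4)%:E)%E by rewrite -EFinM; congr EFin; field.
  rewrite muleC -lee_pdivrMr//.
  by rewrite muleC.
exists (psi n); first by case: (psiC n).
have vpsi : (sobolev_norm G s p (v \- psi n)%R <= (e / 2)%:E)%E.
  apply: (@sobolev_norm_fatou _ _ _ _ _ s_gt0 p_ge2 _ \oo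
    (fun k => (psi k - psi n : V -> R^o))).
    move=> x; change ((fun k => psi k x - psi n x) @ \oo --> v x - psi n x).
    apply: cvgB; last exact: cvg_cst.
    apply/cvgrPdist_le => r r0; near=> k.
    have [_ _ /(_ x)] := psiC k.
    rewrite mem_exhaust distrC => /(_ _)/le_trans; apply.
      by near: k; exact: nbhs_infty_gt.
    near: k; apply: filterS (near_infty_natSinv_lt (PosNum r0)) => k /=.
    exact: ltW.
  near=> k; apply: psi_close; near: k; exact: nbhs_infty_ge.
apply: (le_lt_trans vpsi); rewrite lte_fin; lra.
Unshelve. all: by end_near. Qed.

(** If [phi n] tends to [u] in norm, then [F \o phi n] is bounded in norm and
    tends to [F \o u] pointwise. *)
Theorem sobolev0_contraction (F : R -> R) (u : V -> R) :
  F 0 = 0 -> (forall a b, `|F a - F b| <= `|a - b|) ->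
  sobolev0 G s p u -> sobolev0 G s p (F \o u).
Proof.
move=> F0 FL [/sobolevP uy Hu].
have n0 (n : nat) : 0 < n.+1%:R^-1 :> R by rewrite invr_gt0.
pose phi n := s2val (cid2 (Hu _ (n0 n))).
have phi_fs n : finitely_supported (phi n) by rewrite /phi; case: cid2.
have phi_u n : (sobolev_norm G s p (u \- phi n)%R < n.+1%:R^-1%:E)%E.
  by rewrite /phi; case: cid2.
have ufin : sobolev_norm G s p u \is a fin_num.
  by rewrite ge0_fin_numE; [exact: uy|exact: norm_ge0].
have [K HK] := sobolev_norm_eval_unif.
have phi_cvg x : phi n x @[n --> \oo] --> u x.
  apply/cvgrPdist_le => r r0.
  have K0 : 0 < `|K| + 1 by rewrite ltr_wpDl.
  near=> n; rewrite -lee_fin.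
  apply: (le_trans (HK x (u \- phi n))).
  apply: (@le_trans _ _ ((`|K| + 1)%:E * n.+1%:R^-1%:E)%E).
    apply: (@le_trans _ _ ((`|K| + 1)%:E * sobolev_norm G s p (u \- phi n)%R)%E).
      apply: lee_wpmul2r; first exact: norm_ge0.
      by rewrite lee_fin (le_trans (ler_norm _))// lerDl.
    by apply: lee_wpmul2l; [rewrite lee_fin ltW|exact: ltW (phi_u n)].
  rewrite -EFinM lee_fin mulrC -ler_pdivlMr//.
  near: n; apply: filterS (near_infty_natSinv_lt (PosNum (divr_gt0 r0 K0))) => n /=.
  exact: ltW.
apply: (@sobolev0_bounded_pointwise (fun n => F \o phi n) _
  (fine (sobolev_norm G s p u) + 1)).
- move=> n; apply: sub_finite_set (phi_fs n) => x /=.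
  by apply: contraNN => /eqP ->; rewrite F0.
- move=> n; apply: (@le_trans _ _ (sobolev_norm G s p (phi n))).
    apply: (sobolev_norm_contraction _ s_gt0 p_ge2) => [x|x y] /=; last exact: FL.
    by have := FL (phi n x) 0; rewrite F0 !subr0.
  have -> : phi n = (u : V -> R^o) + - (u \- phi n : V -> R^o).
    by apply/funext => x; change (phi n x = u x - (u x - phi n x)); rewrite subKr.
  apply: (le_trans (normD _ _)); rewrite EFinD fineK//; apply: leeD => //.
  rewrite -scaleN1r normZ normrN1 mul1e; apply: (le_trans (ltW (phi_u n))).
  by rewrite lee_fin invf_le1// ler1n.
- move=> x /=; apply/cvgrPdist_le => r r0.
  move/cvgrPdist_le : (phi_cvg x) => /(_ _ r0); apply: filterS => n.
  exact: le_trans (FL _ _).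
Unshelve. all: by end_near. Qed.

End Sobolev0.

(** * Truncations *)

Lemma max0_contraction (R : realDomainType) (a b : R) :
  `|Num.max a 0 - Num.max b 0| <= `|a - b|.
Proof.
case: (ger0P (a - b)) => ab; rewrite ler_norml;
  by case: (lerP a 0) => a0; case: (lerP b 0) => b0; apply/andP; split; lra.
Qed.

Lemma min0_contraction (R : realDomainType) (a b : R) :
  `|Num.min a 0 - Num.min b 0| <= `|a - b|.
Proof.
case: (ger0P (a - b)) => ab; rewrite ler_norml;
  by case: (lerP a 0) => a0; case: (lerP b 0) => b0; apply/andP; split; lra.
Qed.

Lemma max0_sub_min0 (R : realDomainType) (a : R) :
  Num.max a 0 - Num.min a 0 = `|a|.
Proof.
by case: (lerP a 0) => a0; [rewrite sub0r ler0_norm|rewrite subr0 gtr0_norm].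
Qed.

Theorem theorem2 (R : realType) (V : countType) (G : weighted_graph R V)
    (s p : R)
    (Gconn : connected_graph G) (Glf : locally_finite G)
    (Gsc : stochastically_complete G)
    (s_gt0 : 0 < s) (s_lt1 : s < 1) (p_ge2 : 2 <= p)
    (mu_inf : 0 < inf (range (mu G))) :
  reflexive_banach (sobolev0 G s p) (sobolev_norm G s p) /\
  (forall u : V -> R, sobolev0 G s p u ->
    let up := fun x => Num.max (u x) 0 in
    let um := fun x => Num.min (u x) 0 in
    [/\ sobolev0 G s p up,
        sobolev0 G s p um &
        sobolev0 G s p (up \- um)]).
Proof.
split; first exact: sobolev0_reflexive_banach.
move=> u Hu up um.
split.
- exact: (@sobolev0_contraction _ _ _ _ _ s_gt0 p_ge2 mu_inf (fun a => Num.max a 0) u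
    (maxxx _) (@max0_contraction R) Hu).
- exact: (@sobolev0_contraction _ _ _ _ _ s_gt0 p_ge2 mu_inf (fun a => Num.min a 0) u
    (minxx _) (@min0_contraction R) Hu).
- apply: (@sobolev0_contraction _ _ _ _ _ s_gt0 p_ge2 mu_inf
    (fun a => Num.max a 0 - Num.min a 0) u _ _ Hu) => [|a b].
    by rewrite max0_sub_min0 normr0.
  by rewrite !max0_sub_min0; exact: ler_dist_dist.
Qed.
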